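(* Consider the system $x(s+1)=(1-a(s))x(s)+a(s)[P(s)x(s)+u(s)]$, $s=0,1,\ldots$, in $\mathbb{R}^n$, which satisfies (A1). Suppose there exists a constant $c\in(0,1)$ such that for any $s\ge 0$, $x(s)\in\mathbb{R}^n$, distinct $\xi_1,\ldots,\xi_m\in\{P_{ij}(s),1\le i,j\le n;\ u_i(s),1\le i\le n\}$ and $c_1,\ldots,c_m\in\mathbb{C}$, $$\mathbb{E}\Big[\Big|\sum_{i=1}^m c_i(\xi_i-\mathbb{E}\xi_i)\Big|^2\,\Big|\,x(s)\Big]\ge c\sum_{i=1}^m|c_i|^2\,\mathbb{E}\big[(\xi_i-\mathbb{E}\xi_i)^2\,|\,x(s)\big].$$ In addition, assume one of the following two conditions holds: i) $\inf_{k,s}\mathbb{E}[(u_k(s)-u_k)^2\,|\,x(s)]>0$; ii) $\mathbb{E}[\|u(s)-u\|_2^2\,|\,x(s)]=0$, $u\ne\mathbf{0}_{n\times1}$, $x(0)\ne\mathbf{0}_{n\times1}$, and $\inf_{i,j,s}\mathbb{E}[(P_{ij}(s)-P_{ij})^2\,|\,x(s)]>0$. Then we can choose a real number sequence $\{a(s)\}_{s\ge0}$ independent of $\{x(s)\}_{s\ge0}$ such that $x(s)$ converges to a deterministic vector different from $x(0)$ in mean square if and only if $\widetilde{\rho}_{\max}(P)<1$ or $\widetilde{\rho}_{\min}(P)>1$.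
   Context: Here $P(s)\in\mathbb{R}^{n\times n}$ and $u(s)\in\mathbb{R}^n$, $s\ge 0$, are random matrices and vectors on a common probability space, with entries $P_{ij}(s)$ and $u_i(s)$, $a(s)\in\mathbb{R}$ is the gain, and $x(0)\in\mathbb{R}^n$ is the initial state. For $A\in\mathbb{R}^{n\times n}$ with eigenvalues $\lambda_i(A)$, $\widetilde{\rho}_{\max}(A):=\max_i \mathrm{Re}(\lambda_i(A))$ and $\widetilde{\rho}_{\min}(A):=\min_i\mathrm{Re}(\lambda_i(A))$. (A1): there exist a matrix $P=(P_{ij})\in\mathbb{R}^{n\times n}$ and a vector $u=(u_i)\in\mathbb{R}^n$ such that $\mathbb{E}[P(s)\,|\,x(s)]=P$ and $\mathbb{E}[u(s)\,|\,x(s)]=u$ for any $s\ge 0$ and $x(s)\in\mathbb{R}^n$; also $\mathbb{E}[\|P(s)\|_2^2\,|\,x(s)]$ and $\mathbb{E}[\|u(s)\|_2^2\,|\,x(s)]$ are uniformly bounded. The infima in conditions i) and ii) being positive means that the corresponding conditional expectations are bounded below by one positive constant, for all indices, all $s\ge 0$ and all values of $x(s)$. $x(s)$ converges to a deterministic vector $b$ in mean square if $\lim_{s\to\infty}\mathbb{E}\|x(s)-b\|_2^2=0$.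
   Formalization: The formal theorem additionally assumes P x(0) + u ≠ x(0); otherwise E x(s) = x(0) for all gains, so no limit differs from x(0) and the stated ''if'' fails (e.g. n=1, P(s)=0, u(s)=±1 i.i.d., x(0)=0). *)

(* Defs.v *)
From HB Require Import structures.
From mathcomp Require Import all_boot all_order all_algebra.
From mathcomp Require Import all_classical all_reals all_analysis.
From mathcomp Require Import complex.
Set Implicit Arguments.
Unset Strict Implicit.
Unset Printing Implicit Defensive.
Import Order.TTheory GRing.Theory Num.Theory.
Import numFieldNormedType.Exports.
Local Open Scope classical_set_scope.
Local Open Scope ring_scope.

Section norms_and_spectrum.
Context {R : realType} {n : nat}.
Implicit Types (v : 'cV[R]_n) (A : 'M[R]_n).

(* The library norm on matrices is the max norm, hence these two. *)
Definition l2norm v : R := Num.sqrt (\sum_(i < n) v i ord0 ^+ 2).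

Definition specnorm A : R :=
  sup [set l2norm (A *m v) | v in [set v | l2norm v <= 1]].

Definition re_eigenvalues A : set R :=
  [set complex.Re z | z in
    [set z : R[i] | eigenvalue (map_mx (real_complex R) A) z]].

(* [re_eigenvalues A] is finite, and nonempty when [0 < n]: the supremum and
   infimum are then the maximum and the minimum. *)
Definition rho_max A : R := sup (re_eigenvalues A).
Definition rho_min A : R := inf (re_eigenvalues A).

End norms_and_spectrum.

Section conditional_expectation.
Context {d : measure_display} {T : measurableType d} {R : realType}.
Variable mu : probability T R.

(* [Y] is a version of E[X | G], for a sub-sigma-algebra [G] of the measurable
   sets; versions are unique up to a [mu]-null set. *)
Definition is_cond_exp (G : set (set T)) (X Y : T -> R) : Prop :=
  [/\ mu.-integrable setT (EFin \o X),
      mu.-integrable setT (EFin \o Y),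
      forall B : set R, measurable B -> G (Y @^-1` B) &
      forall A, G A ->
        (\int[mu]_(w in A) (Y w)%:E = \int[mu]_(w in A) (X w)%:E)%E].

Definition cond_exp_le (G : set (set T)) (X : T -> R) (M : R) : Prop :=
  exists2 Y, is_cond_exp G X Y & {ae mu, forall w, Y w <= M}.

Definition cond_exp_ge (G : set (set T)) (X : T -> R) (m : R) : Prop :=
  exists2 Y, is_cond_exp G X Y & {ae mu, forall w, m <= Y w}.

Definition sigma_of {n : nat} (x : T -> 'cV[R]_n) : set (set T) :=
  g_sigma_preimage (fun (i : 'I_n) (w : T) => x w i ord0).

End conditional_expectation.

Section random_linear_system.
Context {d : measure_display} {T : measurableType d} {R : realType} {n : nat}.
Variable mu : probability T R.

Fixpoint trajectory (a : nat -> R) (P : nat -> T -> 'M[R]_n)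
    (u : nat -> T -> 'cV[R]_n) (x0 : 'cV[R]_n) (s : nat) (w : T) : 'cV[R]_n :=
  if s is s'.+1 then
    let x := trajectory a P u x0 s' w in
    (1 - a s') *: x + a s' *: (P s' w *m x + u s' w)
  else x0.

Implicit Types (P : nat -> T -> 'M[R]_n) (u x : nat -> T -> 'cV[R]_n).

Definition A1 P u x (Pbar : 'M[R]_n) (ubar : 'cV[R]_n) : Prop :=
  [/\ forall s i j, is_cond_exp mu (sigma_of (x s))
        (fun w => P s w i j) (cst (Pbar i j)),
      forall s i, is_cond_exp mu (sigma_of (x s))
        (fun w => u s w i ord0) (cst (ubar i ord0)),
      exists M, forall s, cond_exp_le mu (sigma_of (x s))
        (fun w => specnorm (P s w) ^+ 2) M &
      exists M, forall s, cond_exp_le mu (sigma_of (x s))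
        (fun w => l2norm (u s w) ^+ 2) M].

(* Positions of the n * n + n scalar entries of (P(s), u(s)).  Distinct xi_l are
   entries at distinct positions: [k] is injective in [noise_noncancelling]. *)
Definition position : Type := ('I_n * 'I_n) + 'I_n.

Definition entry P u (s : nat) (k : position) (w : T) : R :=
  match k with
  | inl (i, j) => P s w i j
  | inr i => u s w i ord0
  end.

Definition centered (xi : T -> R) (w : T) : R := xi w - fine 'E_mu[xi].

Definition noise_noncancelling P u x (c : R) : Prop :=
  forall (s m : nat) (k : 'I_m -> position) (z : 'I_m -> R[i]),
    injective k ->
    exists (Y : T -> R) (Z : 'I_m -> T -> R),
      [/\ is_cond_exp mu (sigma_of (x s))
            (fun w => Normc.normc (\sum_(l < m)
               z l * real_complex R (centered (entry P u s (k l)) w)) ^+ 2) Y,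
          forall l, is_cond_exp mu (sigma_of (x s))
            (fun w => centered (entry P u s (k l)) w ^+ 2) (Z l) &
          {ae mu, forall w,
            c * \sum_(l < m) Normc.normc (z l) ^+ 2 * Z l w <= Y w}].

Definition noisy_input u x (ubar : 'cV[R]_n) : Prop :=
  exists2 delta : R, 0 < delta & forall s k,
    cond_exp_ge mu (sigma_of (x s))
      (fun w => (u s w k ord0 - ubar k ord0) ^+ 2) delta.

Definition noiseless_input u x (ubar : 'cV[R]_n) : Prop :=
  forall s, is_cond_exp mu (sigma_of (x s))
    (fun w => l2norm (u s w - ubar) ^+ 2) (cst 0).

Definition noisy_matrix P x (Pbar : 'M[R]_n) : Prop :=
  exists2 delta : R, 0 < delta & forall s i j,
    cond_exp_ge mu (sigma_of (x s))
      (fun w => (P s w i j - Pbar i j) ^+ 2) delta.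

Definition cvg_mean_square x (b : 'cV[R]_n) : Prop :=
  ('E_mu[(fun w => l2norm (x s w - b) ^+ 2)%R])%E @[s --> \oo] --> 0%E.

End random_linear_system.

(* Main.v *)
Require Import Defs.
From HB Require Import structures.
From mathcomp Require Import all_boot all_order all_algebra.
From mathcomp Require Import all_classical all_reals all_analysis.
From mathcomp Require Import measurable_realfun spectral complex ring lra.
Set Implicit Arguments.
Unset Strict Implicit.
Unset Printing Implicit Defensive.
Import Order.TTheory GRing.Theory Num.Theory.
Import numFieldNormedType.Exports.
Local Open Scope classical_set_scope.
Local Open Scope ring_scope.

(** Write [H = 1 - Pbar] and [x(s+1) - c' = (1 - a H) (x(s) - c) + a w(s)], where
    [c' = c + a (ubar - H c)] and the noise [w = (P - Pbar) x + (u - ubar)] is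
    conditionally centered.  Hence the moment matrices
    [M(s, c) = E (x(s) - c) (x(s) - c)^T] satisfy
    [M(s+1, c') = (1 - a H) M(s, c) (1 - a H)^T + a^2 E w w^T], and the problem
    becomes deterministic once [E w w^T] is bounded above by a multiple of
    [1 + E |x|^2], by (A1), and below, in every direction, by
    [k0 + k1 E |x|^2], by the non-cancellation hypothesis.

    Sufficiency: [e H] is positive stable for [e = 1] or [e = -1].  Weighting the
    coordinates of a Schur basis by powers of a small [r] gives a Lyapunov function
    for [e H], and with [a(s) = e k / (s + 1)], [k] large, the second moment about
    the solution [b] of [H b = ubar] is [O(1 / s)].

    Necessity: the covariance [S] is positive definite after the first nonzero gain.
    Since [H m - ubar], with [m] the mean, is propagated by the same matrices as the
    fluctuations, [S -> 0] forces [H b = ubar]; so [b != 0] if [ubar != 0], and the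
    noise stays bounded below.  If [v1], [v2] are left eigenvectors of [H] with
    eigenvalues of real parts [al1 <= 0 <= al2], then, once [S] is small, the variance
    of [v_i x(s)] is at least [exp (- 2 al_i A(s))] up to a constant factor, with
    [A(s)] the sum of the gains, and the two cannot vanish together. *)

(** * Conditioning on the current state *)

(** No independence is assumed: [P(s)] and [u(s)] may depend on [x(s)], and the hypotheses are
    usable only through integrals over events of the sigma-algebra of [x(s)]. The noise, however,
    multiplies the state. Its moments are obtained by freezing: [x(s)] is rounded to a grid, hence
    constant on each of countably many such events, and the mesh is sent to 0 by dominated
    convergence. In the necessity part the gains are arbitrary reals, with no sign, smallness or
    summability given. The noise makes up for this. Its contribution [k a(s)^2] to the next variance
    forces [a(s)] to vanish together with the variances, and it pays for the second-order error made
    when [1 - 2 al a(s)] is replaced by [exp (- 2 al a(s))]. This needs a noise bounded below along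
    the whole tail, which is why the limit has to be identified before the eigenvalues are
    compared. *)

Section sub_sigma_algebra.
Context {d : measure_display} {T : measurableType d} {R : realType} {n : nat}.
Variable x : T -> 'cV[R]_n.

Lemma sigma_of_coord (B : set R) j : measurable B ->
  sigma_of x [set w | B (x w j ord0)].
Proof.
move=> mB; apply: sub_sigma_algebra; rewrite -bigcup_seq.
exists j; first by rewrite /= mem_index_enum.
by exists B => //; rewrite setTI.
Qed.

Lemma sigma_of_box (B : 'I_n -> set R) : (forall j, measurable (B j)) ->
  sigma_of x [set w | forall j, B j (x w j ord0)].
Proof.
move=> mB; rewrite (_ : [set w | _] =
    \bigcap_(j in [set: 'I_n]) ((fun w => x w j ord0) @^-1` B j)); last first.
  by apply/seteqP; split=> w /= h => [j _|j]; apply: h.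
apply: (@fin_bigcap_measurable _ (g_sigma_algebraType _)) => // j _.
exact: sigma_of_coord.
Qed.

Lemma sigma_of_cell (f : R -> int) (q : 'cV[int]_n) :
  (forall z, measurable (f @^-1` [set z])) ->
  sigma_of x ((fun w => map_mx f (x w)) @^-1` [set q]).
Proof.
move=> mf; rewrite (_ : _ @^-1` _ =
    [set w | forall j, (f @^-1` [set q j ord0]) (x w j ord0)]).
  exact: (sigma_of_box (B := fun j => f @^-1` [set q j ord0])).
apply/seteqP; split=> w /= h => [j|]; first by rewrite -h mxE.
by apply/matrixP => i j; rewrite mxE ord1 h.
Qed.

Lemma sigma_of_setT : sigma_of x setT.
Proof.
have -> : setT = [set w | forall j, (@setT R) (x w j ord0)] by apply/seteqP; split.
exact: (sigma_of_box (B := fun=> setT)).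
Qed.

Lemma sigma_of_measurable :
  (forall j, measurable_fun setT (fun w => x w j ord0)) ->
  sigma_of x `<=` @measurable d T.
Proof.
move=> mx; rewrite /sigma_of /g_sigma_preimage; apply: smallest_sub.
  exact: sigma_algebra_measurable.
move=> A; rewrite -bigcup_seq => -[j _ [B mB <-]].
exact: mx.
Qed.

End sub_sigma_algebra.

Lemma measurable_floor_cell (R : realType) (k : R) (z : int) :
  measurable ((fun t : R => Num.floor (k * t)) @^-1` [set z]).
Proof.
rewrite (_ : _ @^-1` _ = setT `&` ( *%R k) @^-1` `[z%:~R, (z + 1)%:~R[%classic).
  by apply: (measurable_funM (f := cst k) (g := id)) => //; exact: measurable_itv.
apply/seteqP; split=> t /=; rewrite in_itv /=.
  by move=> <-; split=> //; exact: floor_itv.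
by case=> _ /floor_def.
Qed.

(** * Integrals compared cell by cell on a countable measurable partition *)

Section countable_cells.
Local Open Scope ereal_scope.
Context {d : measure_display} {T : measurableType d} {R : realType}.
Context {J : countType}.
Variables (mu : probability T R) (h : T -> J).
Hypothesis mh : forall q, measurable (h @^-1` [set q]).

(** Countable additivity is stated for sequences of sets, so the fibres of [h] are numbered by
    [pickle]; a number that codes no value of [h] gives the empty set. *)
Let F k := [set w | pickle (h w) = k].

Let FE k : (exists q, F k = h @^-1` [set q]) \/ F k = set0.
Proof.
have [[w <-]|h0] := pselect (exists w, pickle (h w) = k); [left|right].
  exists (h w); apply/seteqP; split=> v; rewrite /F /=; last by move=> ->.
  exact: (pcan_inj pickleK).
by apply/seteqP; split=> // w Fw; apply: h0; exists w.
Qed.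

Let mF k : measurable (F k).
Proof. by case: (FE k) => [[q]|] -> //; exact: mh. Qed.

Let tF : trivIset setT F.
Proof. by move=> i j _ _ [w []]; rewrite /F /= => -> ->. Qed.

Let bF : \bigcup_k F k = setT.
Proof. by apply/seteqP; split=> // w _; exists (pickle (h w)). Qed.

Lemma cells_integral_ge0 (g : T -> R) : mu.-integrable setT (EFin \o g) ->
  (forall q, 0 <= \int[mu]_(w in h @^-1` [set q]) (g w)%:E) ->
  0 <= \int[mu]_w (g w)%:E.
Proof.
move=> ig g0; rewrite -bF integral_bigcup ?bF//.
apply: nneseries_ge0 => k _ _; case: (FE k) => [[q]|] -> //.
by rewrite integral_set0.
Qed.

Lemma cells_ge0_le_integral (f g : T -> R) :
  measurable_fun setT f -> measurable_fun setT g ->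
  (forall w, (0 <= f w)%R) -> (forall w, (0 <= g w)%R) ->
  (forall q, \int[mu]_(w in h @^-1` [set q]) (f w)%:E <=
             \int[mu]_(w in h @^-1` [set q]) (g w)%:E) ->
  \int[mu]_w (f w)%:E <= \int[mu]_w (g w)%:E.
Proof.
move=> mf mg f0 g0 fg; rewrite -bF !ge0_integral_bigcup ?bF//; last 4 first.
- exact/measurable_EFinP.
- by move=> w _; rewrite lee_fin.
- exact/measurable_EFinP.
- by move=> w _; rewrite lee_fin.
apply: lee_nneseries => k _; first by move=> _; apply: integral_ge0 => w _; rewrite lee_fin.
by case: (FE k) => [[q]|] -> //; rewrite !integral_set0.
Qed.

End countable_cells.

Lemma sqr_le_near (R : realFieldType) (a b : R) : -1 <= a - b <= 1 -> a ^+ 2 <= 2 * b ^+ 2 + 2.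
Proof.
move=> ab; have c1 : (a - b) ^+ 2 <= 1 by move: (a - b) ab => c; nra.
have := sqr_ge0 (b - (a - b)); nra.
Qed.

Lemma integral_cst_probability d (T : measurableType d) (R : realType)
  (mu : probability T R) (r : R) : (\int[mu]_w r%:E = r%:E)%E.
Proof. by rewrite integral_cst//= -[RHS]mule1; congr (_ * _)%E; exact: probability_setT. Qed.

Section freezing.
Context {d : measure_display} {T : measurableType d} {R : realType} {n : nat}.
Variables (mu : probability T R) (x : T -> 'cV[R]_n).
Hypothesis mx : forall j, measurable_fun setT (fun w => x w j ord0).

Lemma measurable_floor_comp (k : R) (y : T -> R) : 0 <= k -> measurable_fun setT y ->
  measurable_fun setT (fun w => (Num.floor (k * y w))%:~R : R).
Proof.
move=> k0 my; apply: (measurableT_comp (f := fun t => (Num.floor (k * t))%:~R : R)) => //.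
apply: nondecreasing_measurable => // a b ab.
by rewrite ler_int le_floor// ler_wpM2l.
Qed.

(* Rounding [x] to the integer below freezes it on each cell of a countable
   [sigma_of x]-measurable partition; the rounding error is absorbed in the constants. *)
Lemma cond_bound_sqr (X : T -> R) (M : R) j :
  measurable_fun setT X -> (forall w, 0 <= X w) -> 0 <= M ->
  (forall A, sigma_of x A ->
    (\int[mu]_(w in A) (X w)%:E <= M%:E * mu A)%E) ->
  mu.-integrable setT (fun w => (x w j ord0 ^+ 2)%:E) ->
  (\int[mu]_w (X w * x w j ord0 ^+ 2)%:E <=
     M%:E * (4%:E * \int[mu]_w (x w j ord0 ^+ 2)%:E + 6%:E))%E.
Proof.
move=> mX X0 M0 XM ix.
pose h w := Num.floor (1 * x w j ord0).
pose z w : R := (h w)%:~R.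
have mz : measurable_fun setT z by exact: measurable_floor_comp.
have zx w : z w <= x w j ord0 < z w + 1.
  by rewrite /z /h mul1r; have := floor_itv (x w j ord0); rewrite intrD.
have Gh q : sigma_of x (h @^-1` [set q]).
  exact: (@sigma_of_coord _ _ _ _ x _ j (measurable_floor_cell 1 q)).
have mh q : measurable (h @^-1` [set q]) by exact: (sigma_of_measurable mx).
have mz2 : measurable_fun setT (fun w => 2 * z w ^+ 2 + 2).
  by apply: measurable_funD => //; apply: measurable_funM => //; exact: measurable_funX.
have z20 w : 0 <= 2 * z w ^+ 2 + 2 by have := sqr_ge0 (z w); lra.
apply: (@le_trans _ _ (\int[mu]_w (X w * (2 * z w ^+ 2 + 2))%:E)%E).
  apply: ge0_le_integral => //.
  - by move=> w _; rewrite lee_fin mulr_ge0// sqr_ge0.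
  - by apply/measurable_EFinP; apply: measurable_funM => //; exact: measurable_funX.
  - by apply/measurable_EFinP; exact: measurable_funM.
  - move=> w _; rewrite lee_fin ler_wpM2l//.
    by apply: sqr_le_near; have := zx w; lra.
apply: (@le_trans _ _ (\int[mu]_w (M * (2 * z w ^+ 2 + 2))%:E)%E).
  apply: (cells_ge0_le_integral mh).
  - exact: measurable_funM.
  - exact: measurable_funM.
  - by move=> w; exact: mulr_ge0.
  - by move=> w; exact: mulr_ge0.
  move=> q; pose c : R := 2 * q%:~R ^+ 2 + 2.
  have c0 : 0 <= c by rewrite /c; have := sqr_ge0 (q%:~R : R); lra.
  have -> : (\int[mu]_(w in h @^-1` [set q]) (X w * (2 * z w ^+ 2 + 2))%:E =
      c%:E * \int[mu]_(w in h @^-1` [set q]) (X w)%:E)%E.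
    rewrite -ge0_integralZl//; last 2 first.
    - by apply/measurable_EFinP; exact: measurable_funTS.
    - by move=> w _; rewrite lee_fin.
    by apply: eq_integral => w /set_mem /= hw; rewrite -EFinM mulrC /z hw.
  have -> : (\int[mu]_(w in h @^-1` [set q]) (M * (2 * z w ^+ 2 + 2))%:E =
      c%:E * (M%:E * mu (h @^-1` [set q])))%E.
    rewrite muleA -integral_cst//.
    by apply: eq_integral => w /set_mem /= hw; rewrite -EFinM mulrC /z hw.
  by apply: lee_wpmul2l; [rewrite lee_fin | exact: XM].
under eq_integral do rewrite EFinM.
rewrite ge0_integralZl//; last 2 first.
- exact/measurable_EFinP.
- by move=> w _; rewrite lee_fin.
apply: lee_wpmul2l; first by rewrite lee_fin.
(* The rounding is undone by [z^2 <= 2 x^2 + 2], so [2 z^2 + 2 <= 4 x^2 + 6]. *)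
apply: (@le_trans _ _ (\int[mu]_w (4%:E * (x w j ord0 ^+ 2)%:E + 6%:E))%E).
  apply: ge0_le_integral => //.
  - by move=> w _; rewrite lee_fin.
  - exact/measurable_EFinP.
  - apply/measurable_EFinP; apply: measurable_funD => //; apply: measurable_funM => //.
    exact: measurable_funX.
  - move=> w _; rewrite -EFinM -EFinD lee_fin.
    have : z w ^+ 2 <= 2 * x w j ord0 ^+ 2 + 2 by apply: sqr_le_near; have := zx w; lra.
    lra.
rewrite ge0_integralD//; last 2 first.
- by move=> w _; rewrite mule_ge0// lee_fin sqr_ge0.
- by apply/measurable_EFinP; apply: measurable_funM => //; exact: measurable_funX.
rewrite ge0_integralZl//; last 2 first.
- by apply/measurable_EFinP; exact: measurable_funX.
- by move=> w _; rewrite lee_fin sqr_ge0.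
by rewrite integral_cst_probability.
Qed.

(* Round [x] to the grid of mesh [k.+1%:R^-1]: on each cell the first argument of [F] is
   constant; then let [k] go to infinity by dominated convergence. *)
Lemma freezing (F : 'cV[R]_n -> T -> R) (D : T -> R) :
  (forall y : T -> 'cV[R]_n, (forall j, measurable_fun setT (fun w => y w j ord0)) ->
     measurable_fun setT (fun w => F (y w) w)) ->
  (forall w (p_ : nat -> 'cV[R]_n) (p : 'cV[R]_n),
     (forall j, p_ k j ord0 @[k --> \oo] --> p j ord0) ->
     F (p_ k) w @[k --> \oo] --> F p w) ->
  (forall p w, `|F p w| <= (1 + \sum_j p j ord0 ^+ 2) * D w) ->
  mu.-integrable setT (fun w => ((1 + \sum_j x w j ord0 ^+ 2) * D w)%:E) ->
  (forall p A, sigma_of x A -> (0 <= \int[mu]_(w in A) (F p w)%:E)%E) ->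
  (0 <= \int[mu]_w (F (x w) w)%:E)%E.
Proof.
move=> mF cF FD iD F0.
have D0 w : 0 <= D w.
  have := FD 0 w; rewrite big1 ?addr0 ?mul1r; last by move=> j _; rewrite mxE expr0n.
  exact: le_trans.
pose fl k (t : R) := Num.floor (k.+1%:R * t).
pose q k w : 'cV[R]_n := map_mx (fun t => (fl k t)%:~R / k.+1%:R) (x w).
have flE k t : (fl k t)%:~R / k.+1%:R <= t < (fl k t)%:~R / k.+1%:R + k.+1%:R^-1.
  have k0 : 0 < k.+1%:R :> R by [].
  have := floor_itv (k.+1%:R * t); rewrite -/(fl k t) intrD => /andP[f1 f2].
  by rewrite -[X in _ < _ + X]mul1r -mulrDl ler_pdivrMr// ltr_pdivlMr// [t * _]mulrC f1.
have mq k j : measurable_fun setT (fun w => q k w j ord0).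
  rewrite (_ : (fun w => _) = (fun w => (fl k (x w j ord0))%:~R / k.+1%:R)).
    by apply: measurable_funM => //; exact: measurable_floor_comp.
  by apply/funext => w; rewrite mxE.
(* A dominating function independent of [k]: the mesh is at most 1, so each [q_j^2 <= 2 x_j^2 + 2],
   and [1 + 2 n + 2 |x|^2 <= (2 n + 2) (1 + |x|^2)]. *)
have qD k w : (`|(F (q k w) w)%:E| <=
    (2 * n%:R + 2)%:E * ((1 + \sum_j x w j ord0 ^+ 2) * D w)%:E)%E.
  rewrite -EFinM lee_fin; apply: (le_trans (FD _ _)).
  rewrite mulrA ler_wpM2r//.
  apply: (@le_trans _ _ (1 + \sum_(j < n) (2 * x w j ord0 ^+ 2 + 2))).
    rewrite lerD2l ler_sum// => j _; rewrite mxE /=.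
    have := flE k (x w j ord0).
    have : 0 < (k.+1%:R^-1 : R) <= 1 by rewrite invr_gt0 ltr0n invf_le1//= ler1n.
    move: ((fl k (x w j ord0))%:~R / k.+1%:R : R) (x w j ord0) (k.+1%:R^-1).
    by move=> a b c c1 c2; apply: sqr_le_near; lra.
  rewrite big_split/= -mulr_sumr sumr_const card_ord -[2 *+ n]mulr_natr.
  have : 0 <= \sum_(j < n) x w j ord0 ^+ 2 by rewrite sumr_ge0// => j _; exact: sqr_ge0.
  have : 0 <= n%:R :> R by [].
  move: (\sum_(j < n) _) (n%:R : R) => S N N0 S0; have := mulr_ge0 N0 S0; lra.
have qx w : (F (q k w) w)%:E @[k --> \oo] --> (F (x w) w)%:E.
  apply: cvg_EFin; first exact: nearW.
  apply: cF => j; apply/cvgrPdist_le => e e0; near=> k.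
  have -> : q k w j ord0 = (fl k (x w j ord0))%:~R / k.+1%:R by rewrite mxE.
  have := flE k (x w j ord0); have : k.+1%:R^-1 < e.
    by near: k; exact: near_infty_natSinv_lt (PosNum e0).
  rewrite ler_norml.
  by move: ((fl k (x w j ord0))%:~R / k.+1%:R : R) (x w j ord0) (k.+1%:R^-1) => a b c; lra.
have qF k : (0 <= \int[mu]_w (F (q k w) w)%:E)%E.
  have Gc v := @sigma_of_cell _ _ _ _ x _ v (measurable_floor_cell k.+1%:R).
  apply: (@cells_integral_ge0 _ _ _ _ mu (fun w => map_mx (fl k) (x w))).
  - by move=> v; apply: (sigma_of_measurable mx); exact: Gc.
  - apply: (le_integrable measurableT _ _ (integrableZl measurableT (2 * n%:R + 2) iD)).
      by apply/measurable_EFinP; exact: mF.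
    by move=> w _; apply: (le_trans (qD k w)); rewrite -!EFinM lee_fin ler_norm.
  (* On the cell of [v] the rounded state is a single deterministic vector, to which the hypothesis
     on frozen states applies. *)
  - move=> v; rewrite (eq_integral (fun w => (F (map_mx (fun t => t%:~R / k.+1%:R) v) w)%:E)).
      by apply: F0; exact: Gc.
    move=> w /set_mem /= hv; congr (F _ w)%:E.
    by apply/matrixP => i j; rewrite -hv !mxE.
have [_ _ cvgF] := @dominated_convergence _ _ _ mu setT measurableT
  (fun k w => (F (q k w) w)%:E) (fun w => (F (x w) w)%:E)
  (fun w => ((2 * n%:R + 2)%:E * ((1 + \sum_j x w j ord0 ^+ 2) * D w)%:E)%E)
  (fun k => (measurable_EFinP _ _).2 (mF _ (mq k))) ((measurable_EFinP _ _).2 (mF _ mx))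
  (aeW _ (fun w _ => qx w)) (integrableZl measurableT _ iD) (aeW _ (fun w k _ => qD k w)).
rewrite -(cvg_lim _ cvgF)//; apply: lime_ge; first by apply/cvg_ex; eexists; exact: cvgF.
by apply: nearW => k; exact: qF.
Unshelve. all: end_near. Qed.

End freezing.

(** * Moments of square integrable random vectors *)

Section square_integrable.
Context {d : measure_display} {T : measurableType d} {R : realType}.
Variable mu : probability T R.
Implicit Types f g : T -> R.

Definition sqint f :=
  measurable_fun setT f /\ mu.-integrable setT (EFin \o (fun w => f w ^+ 2)).

Lemma sqint_le f g c : measurable_fun setT f -> 0 <= c ->
  (forall w, f w ^+ 2 <= c * g w) -> mu.-integrable setT (EFin \o g) -> sqint f.
Proof.
move=> mf c0 fg ig; split=> //.
apply: le_integrable (integrableZl _ c ig) => //.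
  by apply/measurable_EFinP; exact: measurable_funX.
move=> w _; rewrite -EFinM !abse_EFin lee_fin ger0_norm ?sqr_ge0//.
exact: le_trans (fg w) (ler_norm _).
Qed.

Lemma sqint_cst c : sqint (cst c).
Proof. by split=> //; exact: (finite_measure_integrable_cst mu (c ^+ 2) measurableT). Qed.

Lemma sqintM f g : sqint f -> sqint g ->
  mu.-integrable setT (EFin \o (fun w => f w * g w)).
Proof.
move=> [mf if_] [mg ig]; apply: le_integrable (integrableD _ if_ ig) => //.
  by apply/measurable_EFinP; exact: measurable_funM.
move=> w _; rewrite -EFinD !abse_EFin lee_fin normrM.
rewrite [leRHS]ger0_norm ?addr_ge0 ?sqr_ge0//.
rewrite -(real_normK (num_real (f w))) -(real_normK (num_real (g w))).
by move: `|f w| `|g w| (normr_ge0 (f w)) (normr_ge0 (g w)) => a b; nra.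
Qed.

Lemma sqintD f g : sqint f -> sqint g -> sqint (fun w => f w + g w).
Proof.
move=> [mf if_] [mg ig]; have iD := integrableD measurableT if_ ig.
apply: (@sqint_le _ (fun w => f w ^+ 2 + g w ^+ 2) 2) => //.
  exact: measurable_funD.
move=> w; have := sqr_ge0 (f w - g w); move: (f w) (g w) => a b; nra.
Qed.

Lemma sqintZ c f : sqint f -> sqint (fun w => c * f w).
Proof.
move=> [mf if_]; apply: (@sqint_le _ (fun w => f w ^+ 2) (c ^+ 2)) => //.
- exact: measurable_funM.
- exact: sqr_ge0.
- by move=> w; rewrite exprMn.
Qed.

Lemma sqint_sum (I : Type) (r : seq I) (f : I -> T -> R) :
  (forall i, sqint (f i)) -> sqint (fun w => \sum_(i <- r) f i w).
Proof.
move=> sf; elim: r => [|i r ih].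
  by rewrite (_ : (fun w => _) = cst 0); [exact: sqint_cst | apply/funext => w; rewrite big_nil].
rewrite (_ : (fun w => _) = (fun w => f i w + \sum_(j <- r) f j w)); first exact: sqintD.
by apply/funext => w; rewrite big_cons.
Qed.

Lemma sqint_integrable f : sqint f -> mu.-integrable setT (EFin \o f).
Proof.
move=> /sqintM /(_ (sqint_cst 1)); congr (mu.-integrable _ _).
by apply/funext => w /=; rewrite mulr1.
Qed.

Lemma Rintegral_sum (D : set T) (I : Type) (r : seq I) (f : I -> T -> R) :
  measurable D -> (forall i, mu.-integrable D (EFin \o f i)) ->
  \int[mu]_(w in D) (\sum_(i <- r) f i w) = \sum_(i <- r) \int[mu]_(w in D) f i w.
Proof.
move=> mD if_; elim: r => [|i r ih].
  rewrite big_nil /Rintegral (eq_integral (cst 0%E)) ?integral0// => w _.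
  by rewrite big_nil.
rewrite big_cons -ih -RintegralD//.
  by apply: eq_Rintegral => w _; rewrite big_cons.
rewrite (_ : EFin \o _ = (fun w => \sum_(i <- r) (f i w)%:E)%E).
  by apply: integrable_sum => // i' _; exact: if_.
by apply/funext => w /=; rewrite sumEFin.
Qed.

Definition sqint_vec {m} (f : T -> 'cV[R]_m) := forall i, sqint (fun w => f w i ord0).

Definition mixed_moment {m p} (f : T -> 'cV[R]_m) (g : T -> 'cV[R]_p) : 'M[R]_(m, p) :=
  \matrix_(i, j) \int[mu]_w (f w i ord0 * g w j ord0).

Lemma sqint_vecD m (f g : T -> 'cV[R]_m) : sqint_vec f -> sqint_vec g ->
  sqint_vec (fun w => f w + g w).
Proof.
move=> sf sg i; have := sqintD (sf i) (sg i).
by congr sqint; apply/funext => w; rewrite mxE.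
Qed.

Lemma sqint_vec_mul m p (B : 'M[R]_(p, m)) (f : T -> 'cV[R]_m) : sqint_vec f ->
  sqint_vec (fun w => B *m f w).
Proof.
move=> sf i; have := sqint_sum (index_enum 'I_m) (fun j => sqintZ (B i j) (sf j)).
by congr sqint; apply/funext => w; rewrite mxE.
Qed.

Lemma sqint_vecZ m c (f : T -> 'cV[R]_m) : sqint_vec f ->
  sqint_vec (fun w => c *: f w).
Proof.
move=> sf i; have := sqintZ c (sf i).
by congr sqint; apply/funext => w; rewrite mxE.
Qed.

Lemma sqint_vec_cst m (c : 'cV[R]_m) : sqint_vec (cst c).
Proof. by move=> i; exact: sqint_cst. Qed.

Lemma mixed_moment_tr m p (f : T -> 'cV[R]_m) (g : T -> 'cV[R]_p) :
  (mixed_moment f g)^T = mixed_moment g f.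
Proof. by apply/matrixP => i j; rewrite !mxE; apply: eq_Rintegral => w _; rewrite mulrC. Qed.

Lemma mixed_moment_linl m m' p (B : 'M[R]_(m', m)) (a : R)
    (f : T -> 'cV[R]_m) (g : T -> 'cV[R]_m') (h : T -> 'cV[R]_p) :
  sqint_vec f -> sqint_vec g -> sqint_vec h ->
  mixed_moment (fun w => B *m f w + a *: g w) h =
  B *m mixed_moment f h + a *: mixed_moment g h.
Proof.
move=> sf sg sh; apply/matrixP => i j; rewrite !mxE.
transitivity (\int[mu]_w ((\sum_k B i k * (f w k ord0 * h w j ord0)) +
    a * (g w i ord0 * h w j ord0))).
  apply: eq_Rintegral => w _; rewrite !mxE mulrDl mulr_suml mulrA.
  by congr (_ + _); apply: eq_bigr => k _; rewrite mulrA.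
have ifh k : mu.-integrable setT (EFin \o (fun w => B i k * (f w k ord0 * h w j ord0))).
  exact: (integrableZl measurableT (B i k) (sqintM (sf k) (sh j))).
rewrite RintegralD//; last 2 first.
- rewrite (_ : EFin \o _ = (fun w => \sum_k (B i k * (f w k ord0 * h w j ord0))%:E)%E).
    by apply: integrable_sum => // k _; exact: ifh.
  by apply/funext => w /=; rewrite sumEFin.
- exact: (integrableZl measurableT a (sqintM (sg i) (sh j))).
rewrite RintegralZl//; last exact: sqintM.
rewrite Rintegral_sum//; congr (_ + _); apply: eq_bigr => k _.
by rewrite mxE RintegralZl//; exact: sqintM.
Qed.

Lemma mixed_moment_mulmx m m' (B : 'M[R]_(m', m)) (f : T -> 'cV[R]_m) :
  sqint_vec f ->
  mixed_moment (fun w => B *m f w) (fun w => B *m f w) = B *m mixed_moment f f *m B^T.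
Proof.
move=> sf; have sBf := sqint_vec_mul B sf.
have lin p (h : T -> 'cV[R]_p) : sqint_vec h ->
    mixed_moment (fun w => B *m f w) h = B *m mixed_moment f h.
  move=> sh; have := mixed_moment_linl B 0 sf sBf sh.
  rewrite scale0r addr0 => <-; congr mixed_moment; apply/funext => w.
  by rewrite scale0r addr0.
by rewrite lin// -mixed_moment_tr lin// trmx_mul mixed_moment_tr mulmxA.
Qed.

(** The cross terms are [a B E f g^T] and its transpose, both zero. This is what closes the
    recursion on second moments. *)
Lemma mixed_moment_affine m (B : 'M[R]_m) a (f g : T -> 'cV[R]_m) :
  sqint_vec f -> sqint_vec g -> mixed_moment f g = 0 ->
  mixed_moment (fun w => B *m f w + a *: g w) (fun w => B *m f w + a *: g w) =
  B *m mixed_moment f f *m B^T + a ^+ 2 *: mixed_moment g g.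
Proof.
move=> sf sg fg0.
have sy : sqint_vec (fun w => B *m f w + a *: g w).
  by apply: sqint_vecD; [exact: sqint_vec_mul | exact: sqint_vecZ].
have gf0 : mixed_moment g f = 0 by rewrite -mixed_moment_tr fg0 trmx0.
rewrite mixed_moment_linl// -[X in _ *m X]mixed_moment_tr -[X in _ *: X]mixed_moment_tr.
rewrite !mixed_moment_linl// fg0 gf0 mulmx0 scaler0 addr0 add0r.
by rewrite !linearZ/= trmx_mul mixed_moment_tr mixed_moment_tr scalerA expr2 mulmxA.
Qed.

Lemma mixed_moment_ge0 m (f : T -> 'cV[R]_m) (v : 'rV[R]_m) : sqint_vec f ->
  0 <= (v *m mixed_moment f f *m v^T) ord0 ord0.
Proof.
move=> sf; rewrite -mixed_moment_mulmx// mxE; apply: Rintegral_ge0 => w _.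
by rewrite -expr2 sqr_ge0.
Qed.

End square_integrable.

(** * One step of the noise *)

(** One more coordinate in Cauchy-Schwarz, without square roots: [(2 s a b)^2 <= 4 a^2 b^2 A B <=
    (a^2 B + b^2 A)^2]. Besides the induction, it serves to adjoin the additive noise [e], with
    coefficient 1, to the coordinates of the state. *)
Lemma cauchy_schwarz_step (R : realFieldType) (s A B a b : R) :
  s ^+ 2 <= A * B -> 0 <= A -> 0 <= B ->
  (s + a * b) ^+ 2 <= (A + a ^+ 2) * (B + b ^+ 2).
Proof.
move=> sAB A0 B0.
have h : 2 * s * a * b <= a ^+ 2 * B + b ^+ 2 * A; last lra.
have p0 : 0 <= a ^+ 2 * B + b ^+ 2 * A by apply: addr_ge0; apply: mulr_ge0 => //; exact: sqr_ge0.
apply: (le_trans (ler_norm _)); rewrite -ler_sqr ?nnegrE//.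
rewrite real_normK ?num_real//.
have := sqr_ge0 (a ^+ 2 * B - b ^+ 2 * A).
have := ler_wpM2l (mulr_ge0 (sqr_ge0 a) (sqr_ge0 b)) sAB.
lra.
Qed.

Lemma cauchy_schwarz_sum (R : realFieldType) (I : Type) (r : seq I) (a b : I -> R) :
  (\sum_(i <- r) a i * b i) ^+ 2 <=
  (\sum_(i <- r) a i ^+ 2) * (\sum_(i <- r) b i ^+ 2).
Proof.
elim: r => [|i r ih]; first by rewrite !big_nil expr0n mulr0.
rewrite !big_cons ![_ ^+ 2 + _]addrC [a i * b i + _]addrC.
by apply: cauchy_schwarz_step => //; apply: sumr_ge0 => j _; exact: sqr_ge0.
Qed.

Lemma integrable_sum_EFin d (T : measurableType d) (R : realType)
    (mu : {measure set T -> \bar R}) (D : set T) (I : Type) (r : seq I) (f : I -> T -> R) :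
  measurable D -> (forall i, mu.-integrable D (EFin \o f i)) ->
  mu.-integrable D (EFin \o (fun w => \sum_(i <- r) f i w)).
Proof.
move=> mD if_; rewrite (_ : EFin \o _ = (fun w => \sum_(i <- r) (f i w)%:E)%E).
  by apply: integrable_sum => // i _; exact: if_.
by apply/funext => w /=; rewrite sumEFin.
Qed.

Lemma integrableD_EFin d (T : measurableType d) (R : realType)
    (mu : {measure set T -> \bar R}) (D : set T) (f g : T -> R) :
  measurable D ->
  mu.-integrable D (EFin \o f) -> mu.-integrable D (EFin \o g) ->
  mu.-integrable D (EFin \o (fun w => f w + g w)).
Proof. by move=> mD if_ ig; exact: (integrableD mD if_ ig). Qed.

Lemma integrableZl_EFin d (T : measurableType d) (R : realType)
    (mu : {measure set T -> \bar R}) (D : set T) (c : R) (f : T -> R) :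
  measurable D -> mu.-integrable D (EFin \o f) ->
  mu.-integrable D (EFin \o (fun w => c * f w)).
Proof. by move=> mD if_; exact: (integrableZl mD c if_). Qed.

Lemma cvg_sum (R : realType) (I : Type) (r : seq I) (f : I -> nat -> R) (l : I -> R) :
  (forall i, f i k @[k --> \oo] --> l i) ->
  \sum_(i <- r) f i k @[k --> \oo] --> \sum_(i <- r) l i.
Proof.
move=> fl; elim: r => [|i r ih].
  by rewrite big_nil; under eq_cvg do rewrite big_nil; exact: cvg_cst.
by rewrite big_cons; under eq_cvg do rewrite big_cons; apply: cvgD; [exact: fl|].
Qed.

Section noise_step.
Context {d : measure_display} {T : measurableType d} {R : realType} {n : nat}.
Variables (mu : probability T R) (x : T -> 'cV[R]_n).
Variables (E : T -> 'M[R]_n) (e : T -> 'cV[R]_n) (M : R).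
Hypothesis sx : sqint_vec mu x.
Hypothesis mE : forall i j, measurable_fun setT (fun w => E w i j).
Hypothesis me : forall i, measurable_fun setT (fun w => e w i ord0).
Hypothesis M0 : 0 <= M.
Hypothesis EM : forall i j A, sigma_of x A ->
  (\int[mu]_(w in A) (E w i j ^+ 2)%:E <= M%:E * mu A)%E.
Hypothesis eM : forall i A, sigma_of x A ->
  (\int[mu]_(w in A) (e w i ord0 ^+ 2)%:E <= M%:E * mu A)%E.

Let mx j : measurable_fun setT (fun w => x w j ord0).
Proof. by have [] := sx j. Qed.

(** The noise with the state frozen at a deterministic [p]; the actual noise is [om (x w) w]. *)
Let om (p : 'cV[R]_n) w : 'cV[R]_n := E w *m p + e w.

Let omE p w i : om p w i ord0 = \sum_j E w i j * p j ord0 + e w i ord0.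
Proof. by rewrite !mxE. Qed.

Let sqint_bounded (f : T -> R) : measurable_fun setT f ->
  (\int[mu]_(w in setT) (f w ^+ 2)%:E <= M%:E * mu setT)%E -> sqint mu f.
Proof.
move=> mf fM; split=> //; apply/integrableP; split.
  by apply/measurable_EFinP; exact: measurable_funX.
under eq_integral do rewrite abse_EFin ger0_norm ?sqr_ge0//.
apply: (le_lt_trans fM); apply: (@le_lt_trans _ _ M%:E); last exact: ltry.
rewrite -[leRHS]mule1; apply: lee_wpmul2l; first by rewrite lee_fin.
exact: probability_le1.
Qed.

Let sE i j : sqint mu (fun w => E w i j).
Proof. by apply: sqint_bounded => //; apply: EM; exact: sigma_of_setT. Qed.

Let se : sqint_vec mu e.
Proof. by move=> i; apply: sqint_bounded => //; apply: eM; exact: sigma_of_setT. Qed.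

(** A product of two square integrable variables is in general only integrable; here it is again
    square integrable because the second moment of [f] is bounded conditionally on [x]. *)
Let sqint_mulx (f : T -> R) k : measurable_fun setT f ->
  (forall A, sigma_of x A -> (\int[mu]_(w in A) (f w ^+ 2)%:E <= M%:E * mu A)%E) ->
  sqint mu (fun w => f w * x w k ord0) /\
  \int[mu]_w ((f w * x w k ord0) ^+ 2) <=
    M * (4 * \int[mu]_w (x w k ord0 ^+ 2) + 6).
Proof.
move=> mf fM; have := @cond_bound_sqr _ _ _ _ mu x mx (fun w => f w ^+ 2) M k
  (measurable_funX _ mf) (fun w => sqr_ge0 _) M0 fM (sx k).2.
under eq_integral do rewrite -exprMn.
have -> : (\int[mu]_w (x w k ord0 ^+ 2)%:E = (\int[mu]_w (x w k ord0 ^+ 2))%:E)%E.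
  by rewrite fineK//; apply: integrable_fin_num => //; exact: (sx k).2.
move=> bnd0; have bnd : (\int[mu]_w ((f w * x w k ord0) ^+ 2)%:E <=
  (M * (4 * \int[mu]_w (x w k ord0 ^+ 2) + 6))%:E)%E := bnd0.
have mfx : measurable_fun setT (fun w => f w * x w k ord0) by exact: measurable_funM.
have ifx : mu.-integrable setT (EFin \o (fun w => (f w * x w k ord0) ^+ 2)).
  apply/integrableP; split; first by apply/measurable_EFinP; exact: measurable_funX.
  under eq_integral do rewrite /= ger0_norm ?sqr_ge0//.
  exact: le_lt_trans bnd (ltry _).
split=> //; rewrite -lee_fin; apply: le_trans bnd; rewrite fineK//.
exact: integrable_fin_num.
Qed.

Lemma sqint_noise : sqint_vec mu (fun w => E w *m x w + e w).
Proof.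
apply: sqint_vecD => // i.
have := sqint_sum (index_enum 'I_n) (fun j => (sqint_mulx j (mE i j) (@EM i j)).1).
by congr sqint; apply/funext => w; rewrite mxE.
Qed.

Lemma noise_second_moment i :
  \int[mu]_w ((E w *m x w + e w) i ord0 ^+ 2) <=
  (n%:R + 1) * (M * (4 * \sum_j \int[mu]_w (x w j ord0 ^+ 2) + 6 * n%:R + 1)).
Proof.
have iEx j := (sqint_mulx j (mE i j) (@EM i j)).1.2.
have iS : mu.-integrable setT
    (EFin \o (fun w => \sum_j (E w i j * x w j ord0) ^+ 2 + e w i ord0 ^+ 2)).
  by apply: (integrableD measurableT (integrable_sum_EFin _ measurableT iEx) (se i).2).
apply: (@le_trans _ _ (\int[mu]_w ((n%:R + 1) *
    (\sum_j (E w i j * x w j ord0) ^+ 2 + e w i ord0 ^+ 2)))).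
  apply: le_Rintegral => //.
  - exact: (sqint_noise i).2.
  - exact: (integrableZl measurableT _ iS).
  - move=> w _; rewrite !mxE.
    (* Cauchy-Schwarz against the vector of ones: the noise coordinate has [n + 1] terms, whence the
       factor [n + 1]. *)
    have := cauchy_schwarz_sum (index_enum 'I_n) (fun j => E w i j * x w j ord0) (fun=> 1).
    rewrite (eq_bigr (fun j => E w i j * x w j ord0)); last by move=> j _; rewrite mulr1.
    rewrite (eq_bigr (fun=> 1) (F1 := fun=> 1 ^+ 2)); last by move=> j _; rewrite expr1n.
    rewrite sumr_const card_ord => cs.
    rewrite mulrC -[e w i ord0 in leLHS]mulr1 -[X in _ * (_ + X)](expr1n R 2).
    by apply: cauchy_schwarz_step => //; apply: sumr_ge0 => j _; exact: sqr_ge0.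
rewrite RintegralZl// RintegralD//; last 2 first.
- exact: integrable_sum_EFin.
- exact: (se i).2.
rewrite ler_wpM2l//.
rewrite Rintegral_sum//.
apply: (@le_trans _ _ (\sum_j M * (4 * \int[mu]_w (x w j ord0 ^+ 2) + 6) + M)).
  apply: lerD.
    by apply: ler_sum => j _; exact: (sqint_mulx j (mE i j) (@EM i j)).2.
  rewrite -lee_fin /Rintegral fineK; last exact: integrable_fin_num (se i).2.
  apply: le_trans; first by apply: eM; exact: sigma_of_setT.
  rewrite -[leRHS]mule1; apply: lee_wpmul2l; first by rewrite lee_fin.
  exact: probability_le1.
rewrite -mulr_sumr big_split/= -mulr_sumr sumr_const card_ord -[6 *+ n]mulr_natr; lra.
Qed.

(** The random factor in all dominations: [|om p|^2 <= (1 + |p|^2) D] by Cauchy-Schwarz, and the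
    summand 1 makes [D >= 1], so that deterministic terms of order [1 + |p|^2] are dominated too. *)
Let D w : R := 1 + (\sum_i \sum_j E w i j ^+ 2 + \sum_i e w i ord0 ^+ 2).

Let D1 w : 1 <= D w.
Proof.
rewrite lerDl addr_ge0// sumr_ge0// => i _; last exact: sqr_ge0.
by rewrite sumr_ge0// => j _; exact: sqr_ge0.
Qed.

Let om_bound p w : \sum_i om p w i ord0 ^+ 2 <= (1 + \sum_j p j ord0 ^+ 2) * D w.
Proof.
have p0 : 0 <= \sum_j p j ord0 ^+ 2 by rewrite sumr_ge0// => j _; exact: sqr_ge0.
apply: (@le_trans _ _ ((1 + \sum_j p j ord0 ^+ 2) *
    (\sum_i \sum_j E w i j ^+ 2 + \sum_i e w i ord0 ^+ 2))); last first.
  by rewrite ler_wpM2l ?addr_ge0// lerDr.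
rewrite -big_split/= mulr_sumr ler_sum// => i _; rewrite omE.
rewrite mulrC -[e w i ord0 in leLHS]mulr1 [1 + _]addrC -[X in _ * (_ + X)](expr1n R 2).
apply: cauchy_schwarz_step => //; last by apply: sumr_ge0 => j _; exact: sqr_ge0.
exact: cauchy_schwarz_sum.
Qed.

(** The product expands into squares of [y], [E_ij y] and [e_i y], with [y] either 1 or a coordinate
    of [x]; all of these are integrable by the conditional bounds. *)
Let integrable_dom : mu.-integrable setT
  (EFin \o (fun w => (1 + \sum_j x w j ord0 ^+ 2) * D w)).
Proof.
have iSS (y : T -> R) : (forall i j, sqint mu (fun w => E w i j * y w)) ->
    (forall i, sqint mu (fun w => e w i ord0 * y w)) -> sqint mu y ->
    mu.-integrable setT (EFin \o (fun w => y w ^+ 2 * D w)).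
  move=> iEy iey iy; rewrite (_ : _ \o _ = EFin \o (fun w => y w ^+ 2 +
    (\sum_i \sum_j (E w i j * y w) ^+ 2 + \sum_i (e w i ord0 * y w) ^+ 2))); last first.
    apply/funext => w; congr EFin; rewrite /D mulrDr mulr1 mulrDr !mulr_sumr.
    congr (_ + (_ + _)); apply: eq_bigr => i _; last by rewrite exprMn mulrC.
    by rewrite mulr_sumr; apply: eq_bigr => j _; rewrite exprMn mulrC.
  apply: integrableD_EFin => //; first exact: iy.2.
  apply: integrableD_EFin => //.
    by apply: integrable_sum_EFin => // i; apply: integrable_sum_EFin => // j; exact: (iEy i j).2.
  by apply: integrable_sum_EFin => // i; exact: (iey i).2.
rewrite (_ : _ \o _ = EFin \o (fun w => 1 ^+ 2 * D w + \sum_j x w j ord0 ^+ 2 * D w)); last first.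
  by apply/funext => w /=; rewrite mulrDl mulr_suml expr1n.
apply: integrableD_EFin => //; [apply: (iSS (cst 1)) | apply: integrable_sum_EFin => //].
- by move=> i j; have := sE i j; congr sqint; apply/funext => w; rewrite mulr1.
- by move=> i; have := se i; congr sqint; apply/funext => w; rewrite mulr1.
- exact: sqint_cst.
- move=> k; apply: iSS => //.
  + by move=> i j; exact: (sqint_mulx k (mE i j) (@EM i j)).1.
  + by move=> i; exact: (sqint_mulx k (me i) (@eM i)).1.
Qed.

Let m_om (y : T -> 'cV[R]_n) i : (forall j, measurable_fun setT (fun w => y w j ord0)) ->
  measurable_fun setT (fun w => om (y w) w i ord0).
Proof.
move=> my; under eq_fun do rewrite omE.
by apply: measurable_funD => //; apply: measurable_sum => j; exact: measurable_funM.
Qed.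

Let cvg_om w (p_ : nat -> 'cV[R]_n) (p : 'cV[R]_n) i :
  (forall j, p_ k j ord0 @[k --> \oo] --> p j ord0) ->
  om (p_ k) w i ord0 @[k --> \oo] --> om p w i ord0.
Proof.
move=> pp; rewrite omE; under eq_cvg do rewrite omE.
by apply: cvgD; [apply: cvg_sum => j; apply: cvgM => //; exact: cvg_cst | exact: cvg_cst].
Qed.

Let freezing_om (F : 'cV[R]_n -> T -> R) (K : R) :
  (forall y : T -> 'cV[R]_n, (forall j, measurable_fun setT (fun w => y w j ord0)) ->
     measurable_fun setT (fun w => F (y w) w)) ->
  (forall w (p_ : nat -> 'cV[R]_n) (p : 'cV[R]_n),
     (forall j, p_ k j ord0 @[k --> \oo] --> p j ord0) ->
     F (p_ k) w @[k --> \oo] --> F p w) ->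
  (forall p w, `|F p w| <= K * ((1 + \sum_j p j ord0 ^+ 2) * D w)) ->
  (forall p A, sigma_of x A -> (0 <= \int[mu]_(w in A) (F p w)%:E)%E) ->
  mu.-integrable setT (EFin \o (fun w => F (x w) w)) /\ 0 <= \int[mu]_w (F (x w) w).
Proof.
move=> mF cF FD F0.
have iF : mu.-integrable setT (EFin \o (fun w => F (x w) w)).
  apply: (le_integrable measurableT _ _ (integrableZl measurableT K integrable_dom)).
    by apply/measurable_EFinP; exact: mF.
  move=> w _; rewrite /= lee_fin; exact: le_trans (FD _ _) (ler_norm _).
split=> //; rewrite -lee_fin /Rintegral fineK; last exact: integrable_fin_num.
apply: (@freezing _ _ _ _ mu x mx F (fun w => K * D w)) => //.
- by move=> p w; rewrite mulrCA.
- rewrite (_ : (fun w => _) = (fun w => K%:E * ((1 + \sum_j x w j ord0 ^+ 2) * D w)%:E)%E).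
    exact: (integrableZl measurableT K integrable_dom).
  by apply/funext => w; rewrite -EFinM mulrCA.
Qed.

Let integrable_om p i (A : set T) : measurable A ->
  mu.-integrable A (EFin \o (fun w => om p w i ord0)).
Proof.
move=> mA; apply: (integrableS measurableT) => //.
rewrite (_ : _ \o _ = EFin \o (fun w => \sum_j p j ord0 * E w i j + e w i ord0)).
  apply: integrableD_EFin => //; last exact: sqint_integrable (se i).
  apply: integrable_sum_EFin => // j; apply: sqint_integrable; exact: sqintZ.
by apply/funext => w /=; rewrite omE; congr (_ + _)%:E; apply: eq_bigr => j _; rewrite mulrC.
Qed.

Lemma noise_uncorrelated (c : 'cV[R]_n) :
  (forall i j A, sigma_of x A -> (\int[mu]_(w in A) (E w i j)%:E = 0)%E) ->
  (forall i A, sigma_of x A -> (\int[mu]_(w in A) (e w i ord0)%:E = 0)%E) ->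
  mixed_moment mu (fun w => x w - c) (fun w => E w *m x w + e w) = 0.
Proof.
move=> E0 e0.
have om0 p i A : sigma_of x A -> \int[mu]_(w in A) om p w i ord0 = 0.
  move=> GA; have mA := sigma_of_measurable mx GA.
  have iE j : mu.-integrable A (EFin \o (fun w => E w i j)).
    by apply: (integrableS measurableT) => //; exact: sqint_integrable.
  rewrite (@eq_Rintegral _ _ _ mu A (fun w => \sum_j p j ord0 * E w i j + e w i ord0)); last first.
    by move=> w _; rewrite omE; congr (_ + _); apply: eq_bigr => j _; rewrite mulrC.
  have iS : mu.-integrable A (EFin \o (fun w => \sum_j p j ord0 * E w i j)).
    by apply: integrable_sum_EFin => // j; exact: (integrableZl mA _ (iE j)).
  have ie : mu.-integrable A (EFin \o (fun w => e w i ord0)).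
    by apply: (integrableS measurableT) => //; exact: sqint_integrable (se i).
  rewrite RintegralD// Rintegral_sum//; last by move=> j; exact: (integrableZl mA _ (iE j)).
  rewrite big1 ?add0r; last by move=> j _; rewrite RintegralZl// /Rintegral E0// mulr0.
  by rewrite /Rintegral e0.
apply/matrixP => i j; rewrite [LHS]mxE [RHS]mxE.
(* Freezing yields only nonnegativity. With the free factor [s] set to [- I], where [I] is the
   integral sought, it gives [- I^2 >= 0], that is [I = 0]. *)
pose F s (p : 'cV[R]_n) w := s * ((p i ord0 - c i ord0) * om p w j ord0).
have FP s : mu.-integrable setT (EFin \o (fun w => F s (x w) w)) /\
    0 <= \int[mu]_w (F s (x w) w).
  (* From [|y o| <= y^2 + o^2] with [y = p_i - c_i]: [y^2] costs [2 + 2 c_i^2], and [o^2] costs 1 by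
     the bound on [om]. *)
  apply: (freezing_om (K := `|s| * (3 + 2 * c i ord0 ^+ 2))).
  - move=> y my; apply: measurable_funM => //; apply: measurable_funM; last exact: m_om.
    exact: measurable_funB.
  - move=> w p_ p pp; apply: cvgM; first exact: cvg_cst.
    by apply: cvgM; [apply: cvgB => //; exact: cvg_cst | exact: cvg_om].
  - move=> p w; rewrite normrM -mulrA ler_wpM2l//.
    have := om_bound p w; rewrite (bigD1 j)//=.
    have : 0 <= \sum_(k < n | k != j) om p w k ord0 ^+ 2.
      by apply: sumr_ge0 => k _; exact: sqr_ge0.
    have : p i ord0 ^+ 2 <= \sum_k p k ord0 ^+ 2.
      by rewrite (bigD1 i)//= lerDl sumr_ge0// => k _; exact: sqr_ge0.
    have := D1 w.
    move: (\sum_(k < n | _) _) (\sum_k _) (D w) (p i ord0) (c i ord0) (om p w j ord0).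
    move=> S Q d' pi ci o d1 piQ S0 oS.
    have Qd : 0 <= (1 + Q - 1 - pi ^+ 2) * d' by rewrite mulr_ge0; nra.
    have h2 : `|(pi - ci) * o| <= (pi - ci) ^+ 2 + o ^+ 2.
      have := sqr_ge0 (pi - ci - o); have := sqr_ge0 (pi - ci + o).
      by have := sqr_ge0 (pi - ci); have := sqr_ge0 o; rewrite ler_norml; nra.
    apply: (le_trans h2).
    have Q0 : 0 <= Q by have := sqr_ge0 pi; lra.
    have h3 : (pi - ci) ^+ 2 <= (2 + 2 * ci ^+ 2) * ((1 + Q) * d').
      apply: (@le_trans _ _ ((2 + 2 * ci ^+ 2) * (1 + Q))); last first.
        rewrite ler_wpM2l//; first by have := sqr_ge0 ci; lra.
        by rewrite ler_peMr//; lra.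
      have := sqr_ge0 (pi + ci); have := mulr_ge0 (sqr_ge0 ci) Q0; nra.
    lra.
  - move=> p A GA; have mA := sigma_of_measurable mx GA.
    rewrite (_ : (\int[mu]_(w in A) (F s p w)%:E)%E = 0%E)//.
    have iF : mu.-integrable A (EFin \o (fun w => (s * (p i ord0 - c i ord0)) * om p w j ord0)).
      exact: (integrableZl mA _ (integrable_om p j mA)).
    rewrite (eq_integral (fun w => ((s * (p i ord0 - c i ord0)) * om p w j ord0)%:E)); last first.
      by move=> w _; rewrite /F mulrA.
    rewrite -[LHS]fineK; last exact: integrable_fin_num.
    by rewrite -/(Rintegral mu A _) RintegralZl ?om0 ?mulr0//; exact: integrable_om.
pose I := \int[mu]_w ((x w - c) i ord0 * (E w *m x w + e w) j ord0).
have IE s : \int[mu]_w (F s (x w) w) = s * I.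
  rewrite -RintegralZl//; last first.
    have := (FP 1).1; congr (mu.-integrable _ _); apply/funext => w.
    by rewrite /F /= mul1r [in RHS]mxE [(- c) _ _]mxE.
  by apply: eq_Rintegral => w _; rewrite /F [in RHS]mxE [(- c) _ _]mxE.
have := (FP (- I)).2; rewrite IE -/I => I2.
by apply/eqP; rewrite -sqrf_eq0 -/I eq_le sqr_ge0 andbT expr2; lra.
Qed.

(** Freezing is applied to the difference of the two sides: a bound valid for every frozen state, on
    every event of the sigma-algebra of [x], holds for the actual state in expectation. *)
Lemma noise_lower_bound (k0 k1 : R) (v : 'rV[R]_n) : 0 <= k0 -> 0 <= k1 ->
  (forall (p : 'cV[R]_n) A, sigma_of x A ->
    ((((v *m v^T) ord0 ord0) * (k0 + k1 * \sum_j p j ord0 ^+ 2))%:E * mu A <=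
     \int[mu]_(w in A) (((v *m (E w *m p + e w)) ord0 ord0) ^+ 2)%:E)%E) ->
  (v *m v^T) ord0 ord0 * (k0 + k1 * \sum_j \int[mu]_w (x w j ord0 ^+ 2)) <=
  \int[mu]_w (((v *m (E w *m x w + e w)) ord0 ord0) ^+ 2).
Proof.
move=> k00 k10 low; set v2 := (v *m v^T) ord0 ord0.
have v2E : v2 = \sum_i v ord0 i ^+ 2.
  by rewrite /v2 mxE; apply: eq_bigr => i _; rewrite mxE expr2.
have v20 : 0 <= v2 by rewrite v2E sumr_ge0// => i _; exact: sqr_ge0.
have vomE p w : (v *m om p w) ord0 ord0 = \sum_i v ord0 i * om p w i ord0 by rewrite mxE.
pose F (p : 'cV[R]_n) w := (v *m om p w) ord0 ord0 ^+ 2 - v2 * (k0 + k1 * \sum_j p j ord0 ^+ 2).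
have mvom (y : T -> 'cV[R]_n) : (forall j, measurable_fun setT (fun w => y w j ord0)) ->
    measurable_fun setT (fun w => (v *m om (y w) w) ord0 ord0).
  move=> my; under eq_fun do rewrite vomE.
  by apply: measurable_sum => i; apply: measurable_funM => //; exact: m_om.
have vom_le p w : (v *m om p w) ord0 ord0 ^+ 2 <= v2 * ((1 + \sum_j p j ord0 ^+ 2) * D w).
  rewrite vomE; apply: (le_trans (cauchy_schwarz_sum _ _ _)).
  by rewrite -v2E ler_wpM2l.
have [iF F0] : mu.-integrable setT (EFin \o (fun w => F (x w) w)) /\
    0 <= \int[mu]_w (F (x w) w).
  apply: (freezing_om (K := v2 * (1 + k0 + k1))).
  - move=> y my; apply: measurable_funB; first by apply: measurable_funX; exact: mvom.
    apply: measurable_funM => //; apply: measurable_funD => //; apply: measurable_funM => //.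
    by apply: measurable_sum => j; exact: measurable_funX.
  - move=> w p_ p pp; rewrite /F vomE; under eq_cvg do rewrite vomE.
    apply: cvgB.
      apply: (@cvg_comp _ _ _ _ (fun t : R => t ^+ 2)); last exact: exprn_continuous.
      by apply: cvg_sum => i; apply: cvgM; [exact: cvg_cst | exact: cvg_om].
    apply: cvgM; first exact: cvg_cst.
    apply: cvgD; first exact: cvg_cst.
    apply: cvgM; first exact: cvg_cst.
    apply: cvg_sum => j; apply: (@cvg_comp _ _ _ _ (fun t : R => t ^+ 2)); first exact: pp.
    exact: exprn_continuous.
  - move=> p w; apply: (le_trans (ler_normB _ _)).
    rewrite ger0_norm ?sqr_ge0// ger0_norm; last first.
      by rewrite mulr_ge0// addr_ge0// mulr_ge0// sumr_ge0// => j _; exact: sqr_ge0.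
    rewrite -mulrA -addrA mulrDl mul1r mulrDr lerD ?vom_le// ler_wpM2l//.
    have Q0 : 0 <= \sum_j p j ord0 ^+ 2 by rewrite sumr_ge0// => j _; exact: sqr_ge0.
    have := D1 w; move: (\sum_j _) (D w) Q0 => Q d' Q0 d1.
    have h : 1 + Q <= (1 + Q) * d' by rewrite ler_peMr//; lra.
    apply: (@le_trans _ _ ((k0 + k1) * (1 + Q))); last by rewrite ler_wpM2l// addr_ge0.
    by have := mulr_ge0 k00 Q0; lra.
  - move=> p A GA; have mA := sigma_of_measurable mx GA; rewrite /F.
    have ivom : mu.-integrable A (EFin \o (fun w => (v *m om p w) ord0 ord0 ^+ 2)).
      apply: (integrableS measurableT) => //.
      have -> : (fun w => (v *m om p w) ord0 ord0 ^+ 2) =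
          (fun w => (\sum_i v ord0 i * (\sum_j p j ord0 * E w i j + e w i ord0)) ^+ 2).
        apply/funext => w; rewrite vomE; congr (_ ^+ 2); apply: eq_bigr => i _.
        by rewrite omE; congr (_ * (_ + _)); apply: eq_bigr => j _; rewrite mulrC.
      have si i : sqint mu (fun w => \sum_j p j ord0 * E w i j + e w i ord0).
        apply: sqintD (se i); apply: sqint_sum => j; exact: sqintZ.
      exact: (sqint_sum (index_enum 'I_n) (fun i => sqintZ (v ord0 i) (si i))).2.
    rewrite integralB_EFin//; last exact: finite_measure_integrable_cst.
    rewrite integral_cst// sube_ge0 ?low//; apply/orP; right; exact: integrable_fin_num.
move: F0.
have -> : (fun w => F (x w) w) = (fun w => (v *m om (x w) w) ord0 ord0 ^+ 2 -
    v2 * (k0 + k1 * \sum_j x w j ord0 ^+ 2)) by [].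
have iS : mu.-integrable setT (EFin \o (fun w => \sum_j x w j ord0 ^+ 2)).
  by apply: integrable_sum_EFin => // j; exact: (sx j).2.
have ik : mu.-integrable setT (EFin \o (fun w => k1 * \sum_j x w j ord0 ^+ 2)).
  exact: (integrableZl measurableT _ iS).
have ic : mu.-integrable setT (EFin \o cst k0) by exact: finite_measure_integrable_cst.
have ikk : mu.-integrable setT (EFin \o (fun w => k0 + k1 * \sum_j x w j ord0 ^+ 2)).
  exact: integrableD_EFin.
have ivom : mu.-integrable setT (EFin \o (fun w => (v *m om (x w) w) ord0 ord0 ^+ 2)).
  apply: (sqint_vec_mul v sqint_noise ord0).2.
rewrite RintegralB//; last exact: (integrableZl measurableT _ ikk).
rewrite subr_ge0 RintegralZl// RintegralD// RintegralZl// Rintegral_sum//; last first.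
  by move=> j; exact: (sx j).2.
by rewrite {1}/Rintegral integral_cst_probability.
Qed.

End noise_step.

(** * Consequences of the hypotheses *)

(** The function [g] is replaced by [max f g], almost everywhere equal to it, so that the comparison
    becomes pointwise. *)
Lemma ae_le_integral_EFin d (T : measurableType d) (R : realType)
    (mu : {measure set T -> \bar R}) (A : set T) (f g : T -> R) : measurable A ->
  mu.-integrable A (EFin \o f) -> mu.-integrable A (EFin \o g) ->
  {ae mu, forall w, f w <= g w} ->
  (\int[mu]_(w in A) (f w)%:E <= \int[mu]_(w in A) (g w)%:E)%E.
Proof.
move=> mA if_ ig fg.
have mf : measurable_fun A f by exact/measurable_EFinP/(measurable_int mu).
have mg : measurable_fun A g by exact/measurable_EFinP/(measurable_int mu).
have mm : measurable_fun A (fun w => Num.max (f w) (g w)) by exact: measurable_maxr.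
rewrite [leRHS](_ : _ = \int[mu]_(w in A) (Num.max (f w) (g w))%:E)%E; last first.
  apply: ae_eq_integral => //; [exact/measurable_EFinP|exact/measurable_EFinP|].
  by apply: filterS fg => w fgw _; rewrite max_r.
apply: le_integral => //; last by move=> w _; rewrite lee_fin le_max lexx.
apply: le_integrable (integrableD mA (integrable_abse if_) (integrable_abse ig)) => //.
  exact/measurable_EFinP.
move=> w _; rewrite /= lee_fin [leRHS]ger0_norm ?addr_ge0//.
by case: (leP (f w) (g w)) => _; rewrite ?lerDl ?lerDr.
Qed.

Section conditional_bounds.
Context {d : measure_display} {T : measurableType d} {R : realType}.
Variables (mu : probability T R) (G : set (set T)).
Hypothesis Gm : G `<=` @measurable d T.

(** The integrated form of a conditional bound no longer mentions the chosen version, and is the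
    form that freezing takes as input. *)
Lemma cond_exp_le_integral (X : T -> R) (M : R) A : cond_exp_le mu G X M -> G A ->
  (\int[mu]_(w in A) (X w)%:E <= M%:E * mu A)%E.
Proof.
move=> [Y [iX iY _ XY] YM] GA; have mA := Gm GA.
rewrite -XY// -integral_cst//; apply: ae_le_integral_EFin => //.
  exact: integrableS iY.
exact: finite_measure_integrable_cst.
Qed.

Lemma cond_exp_ge_integral (X : T -> R) (m : R) A : cond_exp_ge mu G X m -> G A ->
  (m%:E * mu A <= \int[mu]_(w in A) (X w)%:E)%E.
Proof.
move=> [Y [iX iY _ XY] YM] GA; have mA := Gm GA.
rewrite -XY// -integral_cst//; apply: ae_le_integral_EFin => //.
  exact: finite_measure_integrable_cst.
exact: integrableS iY.
Qed.

Lemma cond_exp_cst_integral (X : T -> R) (m : R) A : is_cond_exp mu G X (cst m) -> G A ->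
  (\int[mu]_(w in A) (X w - m)%:E = 0)%E.
Proof.
move=> [iX iY _ XY] GA; have mA := Gm GA.
rewrite integralB_EFin//; last 2 first.
- exact: integrableS iX.
- exact: finite_measure_integrable_cst.
rewrite -XY// subee//; apply: integrable_fin_num => //.
exact: finite_measure_integrable_cst.
Qed.

(** A constant conditional expectation is also the plain mean; hence centering an entry subtracts
    the corresponding entry of [Pbar] or [ubar]. *)
Lemma cond_exp_cst_mean (X : T -> R) (m : R) : is_cond_exp mu G X (cst m) -> G setT ->
  fine ('E_mu[X]) = m.
Proof.
move=> [iX iY _ XY] GT; rewrite unlock -XY//.
by rewrite integral_cst_probability.
Qed.

End conditional_bounds.

Section entry_bounds.
Context {R : realType} {n : nat}.
Implicit Types (v : 'cV[R]_n) (A : 'M[R]_n).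

Lemma sqr_l2norm v : l2norm v ^+ 2 = \sum_i v i ord0 ^+ 2.
Proof. by rewrite sqr_sqrtr// sumr_ge0// => i _; exact: sqr_ge0. Qed.

Lemma l2norm_ge_entry v i : `|v i ord0| <= l2norm v.
Proof.
rewrite -ler_sqr ?nnegrE ?normr_ge0 ?sqrtr_ge0// sqr_l2norm real_normK ?num_real//.
by rewrite (bigD1 i)//= lerDl sumr_ge0// => j _; exact: sqr_ge0.
Qed.

Lemma specnorm_ge A v : l2norm v <= 1 -> l2norm (A *m v) <= specnorm A.
Proof.
move=> v1; apply: ub_le_sup; last by exists v.
(* A [sup] dominates the elements of the set only once the set is known to be bounded above; the
   bound uses [|w_j| <= 1]. *)
exists (Num.sqrt (\sum_i (\sum_j `|A i j|) ^+ 2)) => _ [w /= w1 <-].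
apply: ler_wsqrtr; apply: ler_sum => i _; rewrite mxE.
rewrite -[leLHS]real_normK ?num_real// ler_sqr ?nnegrE ?normr_ge0 ?sumr_ge0//.
apply: (le_trans (ler_norm_sum _ _ _)); apply: ler_sum => j _.
by rewrite normrM ler_piMr// (le_trans (l2norm_ge_entry w j)).
Qed.

Lemma specnorm_ge_entry A i j : `|A i j| <= specnorm A.
Proof.
have <- : (A *m (delta_mx j ord0 : 'cV_n)) i ord0 = A i j by rewrite -colE mxE.
apply: (le_trans (l2norm_ge_entry _ _)); apply: specnorm_ge.
rewrite /l2norm (bigD1 j)//= big1 ?addr0 => [|k kj]; rewrite mxE ?eqxx ?expr1n ?sqrtr1//.
by rewrite (negPf kj) expr0n.
Qed.

End entry_bounds.

(** * Non-degeneracy of the noise in every direction, from the non-cancellation hypothesis *)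

Section noncancelling.
Context {d : measure_display} {T : measurableType d} {R : realType} {n : nat}.
Variables (mu : probability T R).

Lemma sum_position (F : @position n -> R) :
  \sum_(l < #|{: 'I_n * 'I_n + 'I_n}|) F (enum_val l) =
  \sum_i (\sum_j F (inl (i, j)) + F (inr i)).
Proof.
rewrite -(big_enum_val (A := {: 'I_n * 'I_n + 'I_n}) F).
rewrite (eq_bigl predT); last by move=> k; rewrite inE.
rewrite big_sumType/= big_split/= (pair_bigA _ (fun i j => F (inl (i, j)))) /=.
by congr (_ + _); apply: eq_bigr => -[].
Qed.

(** For a frozen state [p], the component of the noise along [v] is a combination of all [n^2 + n]
    centered entries, with coefficients [v_i p_j] on the matrix and [v_i] on the vector. The squares
    of these sum to [|v|^2 |p|^2] and [|v|^2], which produces the weights of [d1] and [d0]. *)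
Lemma noncancelling_lower_bound (P : nat -> T -> 'M[R]_n) (u x : nat -> T -> 'cV[R]_n)
    (Pbar : 'M[R]_n) (ubar : 'cV[R]_n) (c d0 d1 : R) (s : nat)
    (v : 'rV[R]_n) (p : 'cV[R]_n) (A : set T) :
  sigma_of (x s) `<=` @measurable d T ->
  (forall i j, is_cond_exp mu (sigma_of (x s)) (fun w => P s w i j) (cst (Pbar i j))) ->
  (forall i, is_cond_exp mu (sigma_of (x s)) (fun w => u s w i ord0) (cst (ubar i ord0))) ->
  0 < c -> noise_noncancelling mu P u x c ->
  (forall i j A, sigma_of (x s) A ->
     (d1%:E * mu A <= \int[mu]_(w in A) ((P s w i j - Pbar i j) ^+ 2)%:E)%E) ->
  (forall i A, sigma_of (x s) A ->
     (d0%:E * mu A <= \int[mu]_(w in A) ((u s w i ord0 - ubar i ord0) ^+ 2)%:E)%E) ->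
  sigma_of (x s) A ->
  (((v *m v^T) ord0 ord0 * (c * d0 + c * d1 * \sum_j p j ord0 ^+ 2))%:E * mu A <=
   \int[mu]_(w in A)
     (((v *m ((P s w - Pbar) *m p + (u s w - ubar))) ord0 ord0) ^+ 2)%:E)%E.
Proof.
move=> Gm cP cu c0 hnc low1 low0 GA; have mA := Gm _ GA.
pose pos : finType := ('I_n * 'I_n + 'I_n)%type.
pose z (k : pos) : R := match k with inl (i, j) => v ord0 i * p j ord0 | inr i => v ord0 i end.
pose xi (k : pos) (w : T) : R := match k with
  | inl (i, j) => P s w i j - Pbar i j | inr i => u s w i ord0 - ubar i ord0 end.
pose dl (k : pos) : R := match k with inl _ => d1 | inr _ => d0 end.
have GT : sigma_of (x s) setT by exact: sigma_of_setT.
have xiE k : centered mu (entry P u s k) = xi k.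
  apply/funext => w; rewrite /centered; case: k => [[i j]|i] /=.
    by rewrite (cond_exp_cst_mean (cP i j) GT).
  by rewrite (cond_exp_cst_mean (cu i) GT).
have [Y [Z [YP ZP YZ]]] := hnc s #|{: 'I_n * 'I_n + 'I_n}| (fun l => enum_val l)
  (fun l => real_complex R (z (enum_val l))) enum_val_inj.
have normcE (r : R) : Normc.normc (real_complex R r) ^+ 2 = r ^+ 2.
  by rewrite /= expr0n addr0 sqr_sqrtr ?sqr_ge0.
have sumE w : \sum_(l < #|{: 'I_n * 'I_n + 'I_n}|) real_complex R (z (enum_val l)) *
    real_complex R (centered mu (entry P u s (enum_val l)) w) =
    real_complex R ((v *m ((P s w - Pbar) *m p + (u s w - ubar))) ord0 ord0).
  under eq_bigr do rewrite -rmorphM xiE.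
  rewrite -rmorph_sum/=; congr (real_complex R _).
  rewrite (sum_position (fun k => z k * xi k w)) mxE.
  apply: eq_bigr => i _; rewrite !mxE. rewrite [RHS]mulrDr mulr_sumr; congr (_ + _).
  by apply: eq_bigr => j _; rewrite !mxE /=; ring.
have [iX iY _ XY] := YP.
have -> : (\int[mu]_(w in A)
     (((v *m ((P s w - Pbar) *m p + (u s w - ubar))) ord0 ord0) ^+ 2)%:E =
   \int[mu]_(w in A) (Normc.normc (\sum_(l < #|{: 'I_n * 'I_n + 'I_n}|)
     real_complex R (z (enum_val l)) *
     real_complex R (centered mu (entry P u s (enum_val l)) w)) ^+ 2)%:E)%E.
  by apply: eq_integral => w _; rewrite sumE normcE.
rewrite -XY//.
have iZ l : mu.-integrable A (EFin \o (fun w =>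
    Normc.normc (real_complex R (z (enum_val l))) ^+ 2 * Z l w)).
  have [_ iZl _ _] := ZP l.
  by apply: integrableZl_EFin => //; exact: integrableS iZl.
apply: (@le_trans _ _ (\int[mu]_(w in A) (c * \sum_(l < #|{: 'I_n * 'I_n + 'I_n}|)
    Normc.normc (real_complex R (z (enum_val l))) ^+ 2 * Z l w)%:E)%E); last first.
  apply: ae_le_integral_EFin => //.
  - exact: (integrableZl_EFin _ mA (integrable_sum_EFin _ mA iZ)).
  - exact: integrableS iY.
have -> : (\int[mu]_(w in A) (c * \sum_(l < #|{: 'I_n * 'I_n + 'I_n}|)
    Normc.normc (real_complex R (z (enum_val l))) ^+ 2 * Z l w)%:E =
    c%:E * \sum_(l < #|{: 'I_n * 'I_n + 'I_n}|) (z (enum_val l) ^+ 2)%:E *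
      \int[mu]_(w in A) (xi (enum_val l) w ^+ 2)%:E)%E.
  under eq_integral do rewrite EFinM.
  rewrite integralZl//; last exact: integrable_sum_EFin.
  congr (_ * _)%E; under eq_integral do rewrite -sumEFin.
  rewrite integral_sum//; apply: eq_bigr => l _.
  have [_ iZl _ ZX] := ZP l.
  under eq_integral do rewrite normcE EFinM.
  rewrite integralZl//; last exact: integrableS iZl.
  by rewrite ZX// xiE.
have -> : (((v *m v^T) ord0 ord0 * (c * d0 + c * d1 * \sum_j p j ord0 ^+ 2))%:E * mu A =
   c%:E * \sum_(l < #|{: 'I_n * 'I_n + 'I_n}|)
     (z (enum_val l) ^+ 2)%:E * (dl (enum_val l))%:E * mu A)%E.
  have muA : (mu A = (fine (mu A))%:E)%E.
    by rewrite fineK//; exact: fin_num_measure.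
  rewrite muA; transitivity (c%:E * \sum_(l < #|{: 'I_n * 'I_n + 'I_n}|)
      (z (enum_val l) ^+ 2 * dl (enum_val l) * fine (mu A))%:E)%E; last first.
    by congr (_ * _)%E; apply: eq_bigr => l _; rewrite !EFinM.
  rewrite sumEFin -!EFinM; congr EFin.
  rewrite (sum_position (fun k => z k ^+ 2 * dl k * fine (mu A)))/=.
  rewrite mxE mulr_suml mulr_suml [RHS]mulr_sumr; apply: eq_bigr => i _.
  have -> : \sum_j (v ord0 i * p j ord0) ^+ 2 * d1 * fine (mu A) =
      v ord0 i ^+ 2 * (\sum_j p j ord0 ^+ 2) * d1 * fine (mu A).
    by rewrite mulr_sumr !mulr_suml; apply: eq_bigr => j _; rewrite exprMn.
  by rewrite mxE; ring.
apply: lee_wpmul2l; first by rewrite lee_fin ltW.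
apply: lee_sum => l _; rewrite -muleA; apply: lee_wpmul2l; first by rewrite lee_fin sqr_ge0.
by case: (enum_val l) => [[i j]|i] /=; [exact: low1|exact: low0].
Qed.

End noncancelling.

(** * Recursions for the mean and the covariance *)

(** From [(f - b)^2 <= 2 X^2 + 2 b^2], where [X] is to be the norm bounding an entry [f]. The
    absolute value of [M] makes the constant visibly nonnegative. *)
Lemma centered_sqr_bound d (T : measurableType d) (R : realType) (mu : probability T R)
    (G : set (set T)) (f X : T -> R) (b M : R) (A : set T) :
  G `<=` @measurable d T -> measurable_fun setT f ->
  cond_exp_le mu G (fun w => X w ^+ 2) M -> (forall w, `|f w| <= X w) -> G A ->
  (\int[mu]_(w in A) ((f w - b) ^+ 2)%:E <= (2 * `|M| + 2 * b ^+ 2)%:E * mu A)%E.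
Proof.
move=> Gm mf cX fX GA; have mA := Gm _ GA.
have iX : mu.-integrable A (EFin \o (fun w => X w ^+ 2)).
  by have [Y [iX _ _ _] _] := cX; exact: integrableS iX.
have ib : mu.-integrable A (EFin \o (fun=> 2 * b ^+ 2)) by exact: finite_measure_integrable_cst.
have iX2 := integrableZl_EFin 2 mA iX.
apply: (@le_trans _ _ (\int[mu]_(w in A) (2 * X w ^+ 2 + 2 * b ^+ 2)%:E)%E).
  apply: ge0_le_integral => //.
  - by move=> w _; rewrite lee_fin sqr_ge0.
  - apply/measurable_EFinP; apply: measurable_funX; apply: measurable_funB => //.
    exact: measurable_funTS.
  - exact: measurable_int (integrableD_EFin mA iX2 ib).
  - move=> w _; rewrite lee_fin.
    have : f w ^+ 2 <= X w ^+ 2.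
      by rewrite -[leLHS]real_normK ?num_real// ler_sqr ?nnegrE// (le_trans _ (fX w)).
    by have := sqr_ge0 (f w + b); move: (f w) (X w ^+ 2) => ? ?; nra.
rewrite integralD_EFin// integral_cst// EFinD.
rewrite (_ : ((2 * `|M|)%:E + (2 * b ^+ 2)%:E) * mu A =
  (2 * `|M|)%:E * mu A + (2 * b ^+ 2)%:E * mu A)%E; last first.
  by rewrite ge0_muleDl // lee_fin; apply: mulr_ge0 => //; exact: sqr_ge0.
apply: leeD => //. under eq_integral do rewrite /= EFinM.
rewrite integralZl// EFinM -muleA; apply: lee_wpmul2l; first by rewrite lee_fin.
apply: (le_trans (cond_exp_le_integral Gm cX GA)).
by apply: lee_wpmul2r => //; rewrite lee_fin ler_norm.
Qed.

Lemma Rintegral_cst_probability d (T : measurableType d) (R : realType)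
  (mu : probability T R) (r : R) : \int[mu]_w r = r.
Proof. by rewrite /Rintegral integral_cst_probability. Qed.

Section moments.
Context {d : measure_display} {T : measurableType d} {R : realType} {n : nat}.
Variables (mu : probability T R) (a : nat -> R).
Variables (P : nat -> T -> 'M[R]_n) (u : nat -> T -> 'cV[R]_n).
Variables (x0 : 'cV[R]_n) (Pbar : 'M[R]_n) (ubar : 'cV[R]_n).
Let x := trajectory a P u x0.
Hypothesis mP : forall s i j, measurable_fun setT (fun w => P s w i j).
Hypothesis m_u : forall s i, measurable_fun setT (fun w => u s w i ord0).
Hypothesis hA1 : A1 mu P u x Pbar ubar.

Definition noise s w : 'cV[R]_n := (P s w - Pbar) *m x s w + (u s w - ubar).

Definition second_moment s (c : 'cV[R]_n) : 'M[R]_n :=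
  mixed_moment mu (fun w => x s w - c) (fun w => x s w - c).

Definition noise_moment s : 'M[R]_n := mixed_moment mu (noise s) (noise s).

Definition sqr_mean s (c : 'cV[R]_n) : R :=
  \sum_j \int[mu]_w ((x s w - c) j ord0 ^+ 2).

Lemma sqr_mean_trace s c : sqr_mean s c = \tr (second_moment s c).
Proof.
by apply: eq_bigr => j _; rewrite !mxE; apply: eq_Rintegral => w _; rewrite expr2.
Qed.

(** Measurability of [x s] is a premise because the bound feeds the very induction that establishes
    it for trajectories. *)
Lemma noise_entry_bound : exists2 M, 0 <= M &
  forall s, (forall j, measurable_fun setT (fun w => x s w j ord0)) ->
  (forall i j A, sigma_of (x s) A ->
    (\int[mu]_(w in A) (((P s w - Pbar) i j) ^+ 2)%:E <= M%:E * mu A)%E) /\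
  (forall i A, sigma_of (x s) A ->
    (\int[mu]_(w in A) (((u s w - ubar) i ord0) ^+ 2)%:E <= M%:E * mu A)%E).
Proof.
have [_ _ [MP hMP] [Mu hMu]] := hA1.
have S0 : 0 <= \sum_i \sum_j Pbar i j ^+ 2.
  by apply: sumr_ge0 => i _; apply: sumr_ge0 => j _; exact: sqr_ge0.
have U0 : 0 <= \sum_i ubar i ord0 ^+ 2 by apply: sumr_ge0 => i _; exact: sqr_ge0.
exists (2 * `|MP| + 2 * (\sum_i \sum_j Pbar i j ^+ 2) +
        (2 * `|Mu| + 2 * (\sum_i ubar i ord0 ^+ 2))).
  by rewrite !addr_ge0// mulr_ge0.
move=> s mx; have Gm := sigma_of_measurable mx; split=> [i j|i] A GA.
  under eq_integral do rewrite mxE [(- Pbar) _ _]mxE.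
  apply: (le_trans (centered_sqr_bound (Pbar i j) Gm (mP s i j) (hMP s) _ GA)).
    by move=> w; exact: specnorm_ge_entry.
  apply: lee_wpmul2r => //; rewrite lee_fin.
  have : Pbar i j ^+ 2 <= \sum_i \sum_j Pbar i j ^+ 2.
    rewrite (bigD1 i)//= (bigD1 j)//= -addrA lerDl addr_ge0// sumr_ge0// => k _.
      exact: sqr_ge0.
    by apply: sumr_ge0 => l _; exact: sqr_ge0.
  have := normr_ge0 Mu; lra.
under eq_integral do rewrite mxE [(- ubar) _ _]mxE.
apply: (le_trans (centered_sqr_bound (ubar i ord0) Gm (m_u s i) (hMu s) _ GA)).
  by move=> w; exact: l2norm_ge_entry.
apply: lee_wpmul2r => //; rewrite lee_fin.
have : ubar i ord0 ^+ 2 <= \sum_i ubar i ord0 ^+ 2.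
  by rewrite (bigD1 i)//= lerDl sumr_ge0// => k _; exact: sqr_ge0.
have := normr_ge0 MP; lra.
Qed.

Let mE s i j : measurable_fun setT (fun w => (P s w - Pbar) i j).
Proof.
under eq_fun do rewrite mxE [(- Pbar) _ _]mxE.
exact: measurable_funB.
Qed.

Let me s i : measurable_fun setT (fun w => (u s w - ubar) i ord0).
Proof.
under eq_fun do rewrite mxE [(- ubar) _ _]mxE.
exact: measurable_funB.
Qed.

Lemma trajectory_step s w c :
  x s.+1 w - (c + a s *: (ubar - (1%:M - Pbar) *m c)) =
  (1%:M - a s *: (1%:M - Pbar)) *m (x s w - c) + a s *: noise s w.
Proof.
rewrite /noise /= -/x !mulmxBl !mulmxBr !mul1mx -!scalemxAl !mulmxBl !mul1mx.
apply/matrixP => i j; rewrite ord1 !mxE; ring.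
Qed.

Lemma sqint_trajectory s : sqint_vec mu (x s).
Proof.
have [M M0 hM] := noise_entry_bound.
elim: s => [|s sx]; first exact: sqint_vec_cst.
have [EM eM] := hM s (fun j => (sx j).1).
have sn := sqint_noise sx (mE s) (me s) M0 EM eM.
have := sqint_vecD (sqint_vec_mul (1%:M - a s *: (1%:M - Pbar)) sx)
  (sqint_vecD (sqint_vecZ (a s) sn) (sqint_vec_cst mu (a s *: ubar))).
move=> h i; have := h i; congr sqint; apply/funext => w.
have := trajectory_step s w 0.
rewrite mulmx0 !subr0 add0r => /(canRL (subrK _)) ->.
by rewrite addrA.
Qed.

Lemma sigma_of_trajectory s : sigma_of (x s) `<=` @measurable d T.
Proof. by apply: sigma_of_measurable => j; exact: (sqint_trajectory s j).1. Qed.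

Let sxc s c : sqint_vec mu (fun w => x s w - c).
Proof. by apply: sqint_vecD; [exact: sqint_trajectory | exact: sqint_vec_cst]. Qed.

Lemma sqint_vec_noise s : sqint_vec mu (noise s).
Proof.
have [M M0 hM] := noise_entry_bound; have sx := sqint_trajectory s.
have [EM eM] := hM s (fun j => (sx j).1).
exact: (sqint_noise sx (mE s) (me s) M0 EM eM).
Qed.

Lemma noise_uncorrelated_trajectory s c :
  mixed_moment mu (fun w => x s w - c) (noise s) = 0.
Proof.
have [M M0 hM] := noise_entry_bound; have sx := sqint_trajectory s.
have [EM eM] := hM s (fun j => (sx j).1).
have [cP cu _ _] := hA1; have Gm := sigma_of_measurable (fun j => (sx j).1).
apply: (noise_uncorrelated sx (mE s) (me s) M0 EM eM) => [i j|i] A GA.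
  under eq_integral do rewrite mxE [(- Pbar) _ _]mxE.
  exact: (cond_exp_cst_integral Gm (cP s i j) GA).
under eq_integral do rewrite mxE [(- ubar) _ _]mxE.
exact: (cond_exp_cst_integral Gm (cu s i) GA).
Qed.

(** Used at two centers: the solution [b] of [H b = ubar], which does not move, and the mean, which
    moves along [mean_trajectory] and makes this the covariance recursion. *)
Lemma second_moment_step s c :
  second_moment s.+1 (c + a s *: (ubar - (1%:M - Pbar) *m c)) =
  (1%:M - a s *: (1%:M - Pbar)) *m second_moment s c *m
    (1%:M - a s *: (1%:M - Pbar))^T + a s ^+ 2 *: noise_moment s.
Proof.
rewrite -mixed_moment_affine//; last 2 first.
- exact: sqint_vec_noise.
- exact: noise_uncorrelated_trajectory.
by congr mixed_moment; apply/funext => w; exact: trajectory_step.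
Qed.

Lemma second_moment0 : second_moment 0 x0 = 0.
Proof.
apply/matrixP => i j; rewrite !mxE -[RHS](_ : \int[mu]_w (0 : R) = 0).
  by apply: eq_Rintegral => w _; rewrite /= !mxE subrr mul0r.
by rewrite /Rintegral integral0.
Qed.

Lemma second_moment_ge0 s c (v : 'rV[R]_n) :
  0 <= (v *m second_moment s c *m v^T) ord0 ord0.
Proof. by apply: mixed_moment_ge0; exact: sxc. Qed.

Lemma second_moment_sym s c : (second_moment s c)^T = second_moment s c.
Proof. exact: mixed_moment_tr. Qed.

Lemma sqr_mean0E s : sqr_mean s 0 = \sum_j \int[mu]_w (x s w j ord0 ^+ 2).
Proof. by apply: eq_bigr => j _; apply: eq_Rintegral => w _; rewrite subr0. Qed.

Lemma noise_moment_le : exists2 K, 0 <= K &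
  forall s i, noise_moment s i i <= K * (1 + sqr_mean s 0).
Proof.
have [M M0 hM] := noise_entry_bound.
(* With [q] the second moment of the state, [4 q + 6 n + 1 <= (6 n + 5) (1 + q)]. *)
exists ((n%:R + 1) * (M * (6 * n%:R + 5))); first by rewrite !mulr_ge0 ?addr_ge0 ?mulr_ge0.
move=> s i; have sx := sqint_trajectory s.
have [EM eM] := hM s (fun j => (sx j).1).
have := noise_second_moment sx (mE s) (me s) M0 EM eM i.
have -> : noise_moment s i i = \int[mu]_w (noise s w i ord0 ^+ 2).
  by rewrite mxE; apply: eq_Rintegral => w _; rewrite expr2.
rewrite -sqr_mean0E => /le_trans; apply.
rewrite -!mulrA ler_wpM2l ?addr_ge0// ler_wpM2l//.
have : 0 <= sqr_mean s 0 by apply: sumr_ge0 => j _; apply: Rintegral_ge0 => w _; exact: sqr_ge0.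
have : 0 <= n%:R :> R by [].
move: (n%:R : R) (sqr_mean s 0) => N q N0 q0; have := mulr_ge0 N0 q0; lra.
Qed.

Lemma noise_moment_ge (c d0 d1 : R) : 0 < c -> 0 <= d0 -> 0 <= d1 ->
  noise_noncancelling mu P u x c ->
  (forall s i j A, sigma_of (x s) A ->
     (d1%:E * mu A <= \int[mu]_(w in A) ((P s w i j - Pbar i j) ^+ 2)%:E)%E) ->
  (forall s i A, sigma_of (x s) A ->
     (d0%:E * mu A <= \int[mu]_(w in A) ((u s w i ord0 - ubar i ord0) ^+ 2)%:E)%E) ->
  forall s (v : 'rV[R]_n),
  (v *m v^T) ord0 ord0 * (c * d0 + c * d1 * sqr_mean s 0) <=
  (v *m noise_moment s *m v^T) ord0 ord0.
Proof.
move=> c0 d00 d10 hnc low1 low0 s v.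
have [M M0 hM] := noise_entry_bound; have sx := sqint_trajectory s.
have [EM eM] := hM s (fun j => (sx j).1).
have [cP cu _ _] := hA1; have Gm := sigma_of_measurable (fun j => (sx j).1).
have := noise_lower_bound sx (mE s) (me s) M0 EM eM (k0 := c * d0) (k1 := c * d1) (v := v).
rewrite -sqr_mean0E => h.
have -> : (v *m noise_moment s *m v^T) ord0 ord0 =
    \int[mu]_w ((v *m noise s w) ord0 ord0 ^+ 2).
  rewrite -mixed_moment_mulmx; last exact: sqint_vec_noise.
  by rewrite mxE; apply: eq_Rintegral => w _; rewrite expr2.
apply: h; [by rewrite mulr_ge0 // ltW|by rewrite mulr_ge0 // ltW|] => p A GA.
exact: (noncancelling_lower_bound v p Gm (cP s) (cu s) c0 hnc (low1 s) (low0 s) GA).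
Qed.

Fixpoint mean_trajectory s : 'cV[R]_n :=
  if s is s'.+1 then
    mean_trajectory s' + a s' *: (ubar - (1%:M - Pbar) *m mean_trajectory s')
  else x0.

(* Difference of the uncorrelatedness with [x - 0] and with [x - 1]. *)
Lemma noise_mean0 s i : \int[mu]_w (noise s w i ord0) = 0.
Proof.
have sn := sqint_vec_noise s.
have /matrixP/(_ i i) := noise_uncorrelated_trajectory s 0.
have /matrixP/(_ i i) := noise_uncorrelated_trajectory s (const_mx 1).
rewrite !mxE => h1 h0.
have := congr2 (fun s t => s - t) h0 h1; rewrite subrr /= -RintegralB//; last 2 first.
- exact: (sqintM (sxc s 0 i) (sn i)).
- exact: (sqintM (sxc s (const_mx 1) i) (sn i)).
by move=> <-; apply: eq_Rintegral => w _; rewrite !mxE; ring.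
Qed.

Lemma mean_trajectoryE s i : \int[mu]_w (x s w i ord0) = mean_trajectory s i ord0.
Proof.
suff h t : \int[mu]_w ((x t w - mean_trajectory t) i ord0) = 0.
  have := h s; under eq_Rintegral do rewrite mxE [(- mean_trajectory s) _ _]mxE.
  rewrite RintegralB//; last 2 first.
  - exact: sqint_integrable (sqint_trajectory s i).
  - exact: finite_measure_integrable_cst.
  by rewrite Rintegral_cst_probability => /eqP; rewrite subr_eq0 => /eqP.
elim: t i => [|t ih] i.
  rewrite /Rintegral (eq_integral (cst 0%E)) ?integral0// => w _.
  by rewrite subrr mxE.
set B := 1%:M - a t *: (1%:M - Pbar).
transitivity (\int[mu]_w ((\sum_k B i k * (x t w - mean_trajectory t) k ord0) +
    a t * noise t w i ord0)).
  by apply: eq_Rintegral => w _; rewrite trajectory_step -/B mxE; congr (_ + _); rewrite mxE.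
have ix k : mu.-integrable setT (EFin \o (fun w => B i k * (x t w - mean_trajectory t) k ord0)).
  by apply: integrableZl_EFin => //; exact: sqint_integrable (sxc t _ k).
have inz : mu.-integrable setT (EFin \o (fun w => noise t w i ord0)).
  exact: sqint_integrable (sqint_vec_noise t i).
rewrite RintegralD//; last 2 first.
- exact: integrable_sum_EFin.
- exact: integrableZl_EFin.
rewrite RintegralZl// noise_mean0 mulr0 addr0 Rintegral_sum// big1// => k _.
by rewrite RintegralZl ?ih ?mulr0//; exact: sqint_integrable (sxc t _ k).
Qed.

(** Bias-variance decomposition: mean square convergence to [c] means that the trace of the
    covariance vanishes and the mean tends to [c]. *)
Lemma sqr_mean_bias s c : sqr_mean s c =
  sqr_mean s (mean_trajectory s) + \sum_j (mean_trajectory s j ord0 - c j ord0) ^+ 2.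
Proof.
rewrite -big_split/=; apply: eq_bigr => j _; set m := mean_trajectory s.
have i1 := (sxc s m j).2.
have i2 : mu.-integrable setT (EFin \o (fun w => (x s w - m) j ord0)).
  exact: sqint_integrable (sxc s m j).
transitivity (\int[mu]_w ((x s w - m) j ord0 ^+ 2 +
    (2 * (m j ord0 - c j ord0) * (x s w - m) j ord0 + (m j ord0 - c j ord0) ^+ 2))).
  by apply: eq_Rintegral => w _; rewrite !mxE; ring.
have i3 := integrableZl_EFin (2 * (m j ord0 - c j ord0)) measurableT i2.
have i4 : mu.-integrable setT (EFin \o (fun=> (m j ord0 - c j ord0) ^+ 2)).
  exact: finite_measure_integrable_cst.
rewrite RintegralD//; last exact: integrableD_EFin.
rewrite RintegralD// RintegralZl// [X in _ * X](_ : _ = 0) ?mulr0 ?add0r; last first.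
  under eq_Rintegral do rewrite mxE [(- m) _ _]mxE.
  rewrite RintegralB//; last 2 first.
  - exact: sqint_integrable (sqint_trajectory s j).
  - exact: finite_measure_integrable_cst.
  by rewrite mean_trajectoryE Rintegral_cst_probability subrr.
by rewrite Rintegral_cst_probability.
Qed.

Lemma cvg_mean_squareE b :
  cvg_mean_square mu x b <-> sqr_mean s b @[s --> \oo] --> (0 : R).
Proof.
have E s : ('E_mu[(fun w => l2norm (x s w - b) ^+ 2)%R] = (sqr_mean s b)%:E)%E.
  rewrite unlock; under eq_integral do rewrite sqr_l2norm.
  rewrite /sqr_mean -Rintegral_sum//; last by move=> j; exact: (sxc s b j).2.
  rewrite fineK//; apply: integrable_fin_num => //.
  by apply: integrable_sum_EFin => // j; exact: (sxc s b j).2.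
rewrite /cvg_mean_square; under eq_cvg do rewrite E.
by split=> [/fine_cvgP[_]|h]; [exact | apply: cvg_EFin => //; exact: nearW].
Qed.

End moments.

(** * Quadratic forms *)

Section quadratic_form.
Context {R : realFieldType} {n : nat}.
Implicit Types (S : 'M[R]_n) (v w : 'rV[R]_n).

Definition qform S v : R := (v *m S *m v^T) ord0 ord0.

Lemma qformE S v : qform S v = \sum_i \sum_j v ord0 i * v ord0 j * S i j.
Proof.
rewrite /qform mxE exchange_big/=; apply: eq_bigr => j _; rewrite !mxE mulr_suml.
by apply: eq_bigr => i _; ring.
Qed.

Lemma qform_step (B S N : 'M[R]_n) (c : R) v :
  qform (B *m S *m B^T + c *: N) v = qform S (v *m B) + c * qform N v.
Proof.
rewrite /qform mulmxDr mulmxDl [LHS]mxE trmx_mul !mulmxA; congr (_ + _).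
by rewrite -scalemxAr -scalemxAl mxE.
Qed.

Lemma qform1 v : qform 1%:M v = \sum_i v ord0 i ^+ 2.
Proof. by rewrite /qform mulmx1 mxE; apply: eq_bigr => i _; rewrite mxE expr2. Qed.

Lemma qform1_gt0 v : v != 0 -> 0 < qform 1%:M v.
Proof.
move=> v0; rewrite qform1 lt_def sumr_ge0 ?andbT => [|i _]; last exact: sqr_ge0.
apply: contra v0 => /eqP/psumr_eq0P h; apply/eqP/rowP => i; rewrite mxE.
by apply/eqP; rewrite -sqrf_eq0 h// => j _; exact: sqr_ge0.
Qed.

(** The two arguments are the real and imaginary parts of [(c - i e) (v + i w)], and a Hermitian
    form scales by the squared modulus. *)
Lemma qform_rot S v w (c e : R) :
  qform S (c *: v + e *: w) + qform S (c *: w - e *: v) =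
  (c ^+ 2 + e ^+ 2) * (qform S v + qform S w).
Proof.
rewrite !qformE -!big_split/= mulr_sumr; apply: eq_bigr => i _.
rewrite -!big_split/= mulr_sumr; apply: eq_bigr => j _; rewrite !mxE; ring.
Qed.

(** Positivity at [v_i e_i - v_j e_j] bounds the off-diagonal terms by diagonal ones; summing over
    all pairs costs the factor [n]. *)
Lemma qform_le_trace S v : (forall w, 0 <= qform S w) ->
  qform S v <= n%:R * qform 1%:M v * \tr S.
Proof.
move=> Sp.
pose e (i : 'I_n) : 'rV[R]_n := delta_mx ord0 i.
have eSe i j : (e i *m S *m (e j)^T) ord0 ord0 = S i j.
  by rewrite /e trmx_delta -rowE -colE !mxE.
have Sii i : 0 <= S i i by have := Sp (e i); rewrite /qform eSe.
have h i j : v ord0 i * v ord0 j * S i j + v ord0 j * v ord0 i * S j i <=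
    v ord0 i ^+ 2 * S i i + v ord0 j ^+ 2 * S j j.
  have := Sp (v ord0 i *: e i - v ord0 j *: e j); rewrite /qform.
  rewrite [(_ - _)^T]linearB/= ![(_ *: _)^T]linearZ/= !mulmxBl !mulmxBr.
  rewrite -!scalemxAl -!scalemxAr.
  have E (c : R) (A : 'M[R]_1) : (c *: A) ord0 ord0 = c * A ord0 ord0 by rewrite mxE.
  have D (A B : 'M[R]_1) : (A - B) ord0 ord0 = A ord0 ord0 - B ord0 ord0 by rewrite !mxE.
  rewrite !D !E !eSe; lra.
have h2 : 2 * qform S v <= 2 * (n%:R * \sum_i v ord0 i ^+ 2 * S i i).
  have -> : 2 * qform S v = \sum_i \sum_j
      (v ord0 i * v ord0 j * S i j + v ord0 j * v ord0 i * S j i).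
    under [RHS]eq_bigr do rewrite big_split/=.
    by rewrite big_split/= [X in _ + X]exchange_big -qformE mulr_natl mulr2n.
  have -> : 2 * (n%:R * \sum_i v ord0 i ^+ 2 * S i i) = \sum_i \sum_j
      (v ord0 i ^+ 2 * S i i + v ord0 j ^+ 2 * S j j).
    under [RHS]eq_bigr do rewrite big_split/= sumr_const card_ord.
    rewrite big_split/= sumr_const card_ord sumrMnl.
    set F := (\sum_i _); rewrite -[F *+ n]mulr_natl; ring.
  by apply: ler_sum => i _; apply: ler_sum => j _.
have {}h2 : qform S v <= n%:R * \sum_i v ord0 i ^+ 2 * S i i by lra.
apply: (le_trans h2); rewrite -mulrA ler_wpM2l// qform1 mulr_suml.
apply: ler_sum => i _; rewrite ler_wpM2l ?sqr_ge0//.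
by rewrite /mxtrace (bigD1 i)//= lerDl sumr_ge0.
Qed.

End quadratic_form.

(** * Necessity *)

(** Both sides are multiplied by [1 - t > 0]: [exp(t) (1 - t) <= 1] and [(1 + t + 2 t^2) (1 - t) = 1
    + t^2 (1 - 2 t) >= 1]. *)
Lemma expR_le_quadratic (R : realType) (t : R) : `|t| <= 2^-1 ->
  expR t <= 1 + t + 2 * t ^+ 2.
Proof.
rewrite ler_norml => /andP[t1 t2].
have h : 1 - t <= expR (- t) by exact: expR_ge1Dx.
have p : 0 < expR t by exact: expR_gt0.
have : expR t * (1 - t) <= 1.
  by rewrite -[leRHS](expRxMexpNx_1 t) ler_wpM2l// ltW.
move=> e1; have q : 1 <= (1 + t + 2 * t ^+ 2) * (1 - t).
  have : 0 <= t ^+ 2 * (1 - 2 * t) by rewrite mulr_ge0 ?sqr_ge0//; lra.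
  by lra.
have t1' : 0 < 1 - t by lra.
by rewrite -(ler_pM2r t1'); lra.
Qed.

(** By the quadratic bound on [exp], the loss is at most [8 al^2 a^2 W], which the noise term
    [k a^2] covers once [W < k / (8 al^2 + 1)]. That bound requires [|2 al a| <= 1/2]; this follows
    from [k a^2 <= W s.+1 < k / (16 al^2 + 1)], so that the gains become small because [W] does. *)
Lemma exp_growth (R : realType) (W a : nat -> R) (al k : R) (s1 : nat) :
  0 < k ->
  (forall s, (s1 <= s)%N -> (1 - 2 * a s * al) * W s + k * a s ^+ 2 <= W s.+1) ->
  (forall s, (s1 <= s)%N -> k * a s ^+ 2 <= W s.+1) ->
  (forall s, (s1 <= s)%N -> 0 < W s) ->
  W s @[s --> \oo] --> (0 : R) ->
  exists N, forall s, (N <= s)%N -> expR (- (2 * al * a s)) * W s <= W s.+1.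
Proof.
move=> k0 W1 W2 Wp W0.
have small e : 0 < e -> exists N, forall s, (N <= s)%N -> W s < e.
  by move=> e0; move/cvgr_lt : W0 => /(_ _ e0)[N _ hN]; exists N => s Ns; exact: hN.
have al2 := sqr_ge0 al.
have [N1 h1] := small (k / (8 * al ^+ 2 + 1)) ltac:(by rewrite divr_gt0//; lra).
have [N2 h2] := small (k / (16 * al ^+ 2 + 1)) ltac:(by rewrite divr_gt0//; lra).
exists (maxn s1 (maxn N1 N2)) => s; rewrite !geq_max => /and3P[s1s N1s N2s].
have := h1 s N1s; rewrite ltr_pdivlMr; last lra.
have := h2 s.+1 (leqW N2s); rewrite ltr_pdivlMr; last lra.
have := W1 s s1s; have := W2 s s1s; have := Wp s s1s.
move: (W s) (W s.+1) (a s) => w w' x w0 kx w1 h w'1.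
have x2 : 16 * al ^+ 2 * x ^+ 2 <= 1.
  have : k * ((16 * al ^+ 2 + 1) * x ^+ 2) <= k * 1.
    have := sqr_ge0 x; have : (16 * al ^+ 2 + 1) * (k * x ^+ 2) <= (16 * al ^+ 2 + 1) * w'.
      by rewrite ler_wpM2l//; lra.
    lra.
  by rewrite ler_pM2l// => ?; have := sqr_ge0 x; lra.
have t2 : `|- (2 * al * x)| <= 2^-1.
  rewrite -ler_sqr ?nnegrE ?normr_ge0 ?invr_ge0// real_normK ?num_real//.
  by rewrite exprVn; lra.
apply: (@le_trans _ _ ((1 + - (2 * al * x) + 2 * (- (2 * al * x)) ^+ 2) * w)).
  by rewrite ler_wpM2r ?expR_le_quadratic// ltW.
have : x ^+ 2 * (8 * al ^+ 2 * w) <= x ^+ 2 * k by rewrite ler_wpM2l ?sqr_ge0//; lra.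
lra.
Qed.

Lemma exp_growth_sum (R : realType) (W a : nat -> R) (al : R) (N : nat) :
  (forall s, (N <= s)%N -> expR (- (2 * al * a s)) * W s <= W s.+1) ->
  forall m,
  expR (- (2 * al * \sum_(i < m) a (N + i)%N)) * W N <= W (N + m)%N.
Proof.
move=> h; elim => [|m ih]; first by rewrite big_ord0 mulr0 oppr0 expR0 mul1r addn0.
rewrite big_ord_recr/= mulrDr opprD expRD mulrAC addnS.
apply: le_trans (h _ (leq_addr _ _)); rewrite mulrC ler_wpM2l // ltW // expR_gt0.
Qed.

(* [expR (- 2 al1 A)] and [expR (- 2 al2 A)], with [A] the sum of the gains,
   cannot both be below 1 when [al1 <= 0 <= al2]. *)
Lemma opposite_growth (R : realType) (W1 W2 a : nat -> R) (al1 al2 k : R) (s1 : nat) :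
  0 < k -> al1 <= 0 -> 0 <= al2 ->
  (forall s, (s1 <= s)%N -> (1 - 2 * a s * al1) * W1 s + k * a s ^+ 2 <= W1 s.+1) ->
  (forall s, (s1 <= s)%N -> (1 - 2 * a s * al2) * W2 s + k * a s ^+ 2 <= W2 s.+1) ->
  (forall s, (s1 <= s)%N -> k * a s ^+ 2 <= W1 s.+1) ->
  (forall s, (s1 <= s)%N -> k * a s ^+ 2 <= W2 s.+1) ->
  (forall s, (s1 <= s)%N -> 0 < W1 s) -> (forall s, (s1 <= s)%N -> 0 < W2 s) ->
  W1 s @[s --> \oo] --> (0 : R) -> W2 s @[s --> \oo] --> (0 : R) -> False.
Proof.
move=> k0 al10 al20 h1 h2 g1 g2 p1 p2 c1 c2.
have [N1 e1] := exp_growth k0 h1 g1 p1 c1.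
have [N2 e2] := exp_growth k0 h2 g2 p2 c2.
pose N := maxn s1 (maxn N1 N2).
have [Ns [NN1 NN2]] : ((s1 <= N)%N * ((N1 <= N)%N * (N2 <= N)%N))%type.
  by rewrite /N !leq_max !leqnn !orbT.
have E1 m := exp_growth_sum (fun s Ns' => e1 s (leq_trans NN1 Ns')) m.
have E2 m := exp_growth_sum (fun s Ns' => e2 s (leq_trans NN2 Ns')) m.
have [M1 _ m1] : \forall s \near \oo, W1 s < W1 N.
  by move/cvgr_lt : c1; apply; exact: p1.
have [M2 _ m2] : \forall s \near \oo, W2 s < W2 N.
  by move/cvgr_lt : c2; apply; exact: p2.
(* At time [N + m] both sequences lie below their values at [N], so [al1] and [al2] both have a
   positive product with one and the same sum of gains. *)
pose m := maxn M1 M2.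
have l1 : W1 (N + m)%N < W1 N.
  by apply: m1; rewrite /= (leq_trans _ (leq_addl _ _))// leq_maxl.
have l2 : W2 (N + m)%N < W2 N.
  by apply: m2; rewrite /= (leq_trans _ (leq_addl _ _))// leq_maxr.
have lt0 al (w w' : R) : 0 < w -> w' < w ->
    expR (- (2 * al * \sum_(i < m) a (N + i)%N)) * w <= w' ->
    0 < al * \sum_(i < m) a (N + i)%N.
  move: (\sum_(i < m) _) => A w0 ww' ew; rewrite ltNge; apply/negP => neg.
  have : 1 <= expR (- (2 * al * A)) by rewrite -[leLHS]expR0 ler_expR; lra.
  by move=> ge1; have := ler_wpM2r (ltW w0) ge1; lra.
have := lt0 _ _ _ (p1 N Ns) l1 (E1 m); have := lt0 _ _ _ (p2 N Ns) l2 (E2 m).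
move: (\sum_(i < m) _) => A A2 A1; have [A0|A0] := leP 0 A.
  by have := mulr_le0_ge0 al10 A0; lra.
by have := mulr_ge0_le0 al20 (ltW A0); lra.
Qed.

(** * The deterministic recursion of mean and covariance, and the limits it allows *)

Section unstable.
Context {R : realType} {n : nat}.
Variables (H : 'M[R]_n) (a : nat -> R) (S N : nat -> 'M[R]_n) (m : nat -> 'cV[R]_n).
Variables (b ubar : 'cV[R]_n) (k0 k1 : R).
Let B s := 1%:M - a s *: H.
Let q s := \tr (S s) + \sum_j m s j ord0 ^+ 2.
Hypothesis S_step : forall s, S s.+1 = B s *m S s *m (B s)^T + a s ^+ 2 *: N s.
Hypothesis m_step : forall s, m s.+1 = m s + a s *: (ubar - H *m m s).
Hypothesis S_ge0 : forall s v, 0 <= qform (S s) v.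
Hypothesis N_ge : forall s v, qform 1%:M v * (k0 + k1 * q s) <= qform (N s) v.
Hypothesis S0 : S 0 = 0.
Hypothesis k00 : 0 <= k0.
Hypothesis k10 : 0 <= k1.
Hypothesis b0 : b != m 0.
Hypothesis noisy : 0 < k0 \/ [/\ 0 < k1, ubar != 0 & m 0 != 0].
Hypothesis cvgS : \tr (S s) @[s --> \oo] --> (0 : R).
Hypothesis cvgm : forall j, m s j ord0 @[s --> \oo] --> b j ord0.

Let qform1_ge0 (v : 'rV[R]_n) : 0 <= qform 1%:M v.
Proof. by rewrite qform1 sumr_ge0// => i _; exact: sqr_ge0. Qed.

Let trS_ge0 s : 0 <= \tr (S s).
Proof.
apply: sumr_ge0 => i _; have := S_ge0 s (delta_mx ord0 i).
by rewrite /qform trmx_delta -rowE -colE !mxE.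
Qed.

Let q_ge0 s : 0 <= q s.
Proof. by rewrite addr_ge0// sumr_ge0// => j _; exact: sqr_ge0. Qed.

Let q_ge s j : m s j ord0 ^+ 2 <= q s.
Proof.
rewrite /q (bigD1 j)//= addrCA lerDl addr_ge0// sumr_ge0// => i _; exact: sqr_ge0.
Qed.

Let qformS s v : qform (S s.+1) v = qform (S s) (v *m B s) + a s ^+ 2 * qform (N s) v.
Proof. by rewrite S_step qform_step. Qed.

Let N_ge0 s (v : 'rV[R]_n) : 0 <= qform (N s) v.
Proof. by apply: le_trans (N_ge s v); rewrite mulr_ge0// addr_ge0// mulr_ge0. Qed.

(** Some gain is nonzero, since otherwise the mean would stay at [m 0], which differs from [b]. As
    [B s] may be singular, positivity cannot be transported through it; each nonzero gain recreates
    it from the noise term alone. When that term is controlled by [k1 q], one needs [q > 0]: at the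
    first nonzero gain the mean is still [m 0], and afterwards the previous covariance has positive
    trace. The constant [e] depends on [s]. *)
Let nondegenerate : exists s0, forall s, (s0 <= s)%N ->
  exists2 e, 0 < e & forall v, e * qform 1%:M v <= qform (S s) v.
Proof.
have [s as0] : exists s, a s != 0.
  apply: contrapT => /forallNP a0; move/eqP: b0; apply.
  have mE s : m s = m 0.
    elim: s => // s ih; rewrite m_step ih.
    by have /negP := a0 s; rewrite negbK => /eqP ->; rewrite scale0r addr0.
  apply/matrixP => i j; rewrite ord1 -(cvg_lim (@Rhausdorff R) (@cvgm i)).
  by apply: (cvg_lim (@Rhausdorff R)); under eq_cvg do rewrite mE; exact: cvg_cst.
pose s1 := ex_minn (ex_intro (fun s => a s != 0) s as0).
have [as1 min1] : a s1 != 0 /\ forall t, (t < s1)%N -> a t = 0.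
  rewrite /s1; case: ex_minnP => t at0 mint; split=> // r rt.
  by apply/eqP; apply: contraLR rt => /mint; rewrite -leqNgt.
have init t : (t <= s1)%N -> m t = m 0 /\ S t = 0.
  elim: t => // t ih ts; have [mt St] := ih (ltnW ts).
  rewrite m_step S_step min1// St scale0r addr0 mt; split=> //.
  by rewrite mulmx0 mul0mx expr0n scale0r addr0.
have [ms1 _] := init s1 (leqnn _).
have kp t : (m 0 != 0 -> 0 < q t) -> 0 < k0 + k1 * q t.
  case: noisy => [k0p _|[k1p _ m00] /(_ m00) qt]; first by rewrite ltr_pwDl// mulr_ge0.
  by rewrite ltr_wpDl// mulr_gt0.
exists s1.+1 => s'; elim: s' => // s' ih.
rewrite ltnS leq_eqVlt => /predU1P[<-|ss'].
  exists (a s1 ^+ 2 * (k0 + k1 * q s1)) => [|v].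
    rewrite mulr_gt0//; first by rewrite lt_def sqrf_eq0 as1 sqr_ge0.
    apply: kp => m00; have [j mj] : exists j, m 0 j ord0 != 0.
      apply: contrapT => /forallNP mj; move/eqP: m00; apply; apply/matrixP => i j.
      by rewrite ord1 mxE; apply/eqP; have /negP := mj i; rewrite negbK.
    by apply: lt_le_trans (q_ge s1 j); rewrite ms1 lt_def sqrf_eq0 mj sqr_ge0.
  rewrite qformS -mulrA; apply: (@le_trans _ _ (a s1 ^+ 2 * qform (N s1) v)).
    by rewrite ler_wpM2l ?sqr_ge0// mulrC.
  by rewrite lerDr.
have [e e0 he] := ih ss'.
have [as0'|as0'] := eqVneq (a s') 0.
  exists e => // v; rewrite qformS as0' expr0n mul0r addr0.
  by rewrite /B as0' scale0r subr0 mulmx1.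
exists (a s' ^+ 2 * (k0 + k1 * q s')) => [|v].
  rewrite mulr_gt0//; first by rewrite lt_def sqrf_eq0 as0' sqr_ge0.
  apply: kp => m00.
  have v0 : (m 0)^T != 0 by rewrite trmx_eq0.
  have := lt_le_trans (mulr_gt0 e0 (qform1_gt0 v0)) (he _).
  move=> /lt_le_trans /(_ (qform_le_trace _ (S_ge0 s'))) tr0.
  have : 0 < \tr (S s').
    rewrite lt_def trS_ge0 andbT; apply/eqP => t0.
    by move: tr0; rewrite t0 mulr0 ltxx.
  by move/lt_le_trans; apply; rewrite lerDl sumr_ge0// => j _; exact: sqr_ge0.
rewrite qformS -mulrA; apply: (@le_trans _ _ (a s' ^+ 2 * qform (N s') v)).
  by rewrite ler_wpM2l ?sqr_ge0// mulrC.
by rewrite lerDr.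
Qed.

Let cvg_qform v : qform (S s) v @[s --> \oo] --> (0 : R).
Proof.
apply: (@squeeze_cvgr _ _ _ _ (cst 0) (fun s => n%:R * qform 1%:M v * \tr (S s))).
- by near=> s; rewrite S_ge0/=; exact: qform_le_trace.
- exact: cvg_cst.
- rewrite -(mulr0 (n%:R * qform 1%:M v)); apply: cvgM => //; exact: cvg_cst.
Unshelve. all: end_near. Qed.

(* [H *m m s - ubar] is propagated by the same matrices [B s] as the
   fluctuations, hence vanishes with them. *)
Let limit_fixed : H *m b = ubar.
Proof.
have [s0 nd] := nondegenerate.
pose g s := H *m m s - ubar.
have gS s : g s.+1 = B s *m g s.
  rewrite /g m_step /B mulmxDr mulmxBl mul1mx -scalemxAr -scalemxAl.
  by rewrite addrAC -[ubar - _]opprB mulmxN scalerN.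
(* As quadratic forms, [g g^T <= C S]. This holds at [s0] because [S s0] is positive definite, and
   it persists because [B s] acts on both sides alike while the noise only increases the right
   one. *)
have [C hC] : exists C, forall s, (s0 <= s)%N -> forall v : 'rV[R]_n,
    (v *m g s) ord0 ord0 ^+ 2 <= C * qform (S s) v.
  have [e e0 he] := nd s0 (leqnn _).
  pose G := \sum_j g s0 j ord0 ^+ 2.
  have G0 : 0 <= G by rewrite sumr_ge0// => j _; exact: sqr_ge0.
  have base v : (v *m g s0) ord0 ord0 ^+ 2 <= G / e * qform (S s0) v.
    rewrite mxE; apply: (le_trans (cauchy_schwarz_sum _ _ _)); rewrite -qform1 mulrC -mulrA.
    by rewrite ler_wpM2l// mulrC ler_pdivlMr// mulrC.
  exists (G / e); elim=> [|s ih]; first by rewrite leqn0 => /eqP s00 v; move: (base v); rewrite s00.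
  rewrite leq_eqVlt => /predU1P[<- //|s0s] v.
  rewrite gS mulmxA; apply: (le_trans (ih s0s _)).
  apply: ler_wpM2l; first by rewrite divr_ge0// ltW.
  by rewrite qformS lerDl mulr_ge0 ?sqr_ge0.
apply/eqP; rewrite -subr_eq0; apply/eqP/matrixP => i j; rewrite ord1 [RHS]mxE => {j}.
have gi s : ((delta_mx ord0 i : 'rV[R]_n) *m g s) ord0 ord0 = g s i ord0 by rewrite -rowE mxE.
have cg : g s i ord0 @[s --> \oo] --> (H *m b - ubar) i ord0.
  have -> : (H *m b - ubar) i ord0 = \sum_k H i k * b k ord0 - ubar i ord0 by rewrite !mxE.
  have -> : (fun s => g s i ord0) = (fun s => \sum_k H i k * m s k ord0 - ubar i ord0).
    by apply/funext => s; rewrite !mxE.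
  by apply: cvgB; [apply: cvg_sum => k; apply: cvgM => //|]; exact: cvg_cst.
have cg0 : g s i ord0 ^+ 2 @[s --> \oo] --> (0 : R).
  apply: (@squeeze_cvgr _ _ _ _ (cst 0) (fun s => C * qform (S s) (delta_mx ord0 i))).
  - near=> s; rewrite sqr_ge0/= -gi; apply: hC.
    by near: s; exact: nbhs_infty_ge.
  - exact: cvg_cst.
  - by rewrite -(mulr0 C); apply: cvgM; [exact: cvg_cst | exact: cvg_qform].
apply/eqP; rewrite -sqrf_eq0; apply/eqP.
rewrite -(cvg_lim (@Rhausdorff R) cg0); symmetry; apply: (cvg_lim (@Rhausdorff R)).
by apply: (@cvg_comp _ _ _ _ (fun t : R => t ^+ 2)); [exact: cg | exact: exprn_continuous].
Unshelve. all: end_near. Qed.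

Let noise_floor : exists2 k, 0 < k & exists s1, forall s, (s1 <= s)%N -> k <= k0 + k1 * q s.
Proof.
case: noisy => [k0p|[k1p u0 _]].
  by exists k0 => //; exists 0 => s _; rewrite lerDl mulr_ge0.
have [j bj] : exists j, b j ord0 != 0.
  apply: contrapT => /forallNP bj; move/eqP: u0; apply.
  rewrite -limit_fixed (_ : b = 0) ?mulmx0//; apply/matrixP => i j.
  by rewrite ord1 mxE; apply/eqP; have /negP := bj i; rewrite negbK.
have b2 : 0 < b j ord0 ^+ 2 by rewrite lt_def sqrf_eq0 bj sqr_ge0.
have : m s j ord0 ^+ 2 @[s --> \oo] --> b j ord0 ^+ 2.
  by apply: (@cvg_comp _ _ _ _ (fun t : R => t ^+ 2)); [exact: cvgm | exact: exprn_continuous].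
move=> /cvgr_gt /(_ (b j ord0 ^+ 2 / 2)) [|s1 _ hs]; first lra.
exists (k1 * (b j ord0 ^+ 2 / 2)); first by rewrite mulr_gt0//; lra.
exists s1 => s s1s; rewrite -[leLHS]add0r lerD// ler_wpM2l//.
by apply: (le_trans _ (q_ge s j)); apply/ltW; exact: hs.
Qed.

(** Here [p + i r] is a left eigenvector of [H] for [z = al + i be], so [B s] multiplies it by
    [1 - a z]. By [qform_rot] the sum of the two forms is scaled by [|1 - a z|^2 >= 1 - 2 a al], and
    the noise adds at least a multiple of [a^2]. *)
Let growth (p r : 'rV[R]_n) al be : (p != 0) || (r != 0) ->
  p *m H = al *: p - be *: r -> r *m H = be *: p + al *: r ->
  exists2 k, 0 < k & exists s1,
    [/\ forall s, (s1 <= s)%N ->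
      (1 - 2 * a s * al) * (qform (S s) p + qform (S s) r) + k * a s ^+ 2 <=
      qform (S s.+1) p + qform (S s.+1) r,
    forall s, (s1 <= s)%N -> k * a s ^+ 2 <= qform (S s.+1) p + qform (S s.+1) r &
    forall s, (s1 <= s)%N -> 0 < qform (S s) p + qform (S s) r].
Proof.
move=> pr0 pH rH; have [k kp [s1 hk]] := noise_floor; have [s0 nd] := nondegenerate.
have w0 : 0 < qform 1%:M p + qform 1%:M r.
  case/orP: pr0 => v0; first by rewrite ltr_pwDl// qform1_gt0.
  by rewrite ltr_wpDl// qform1_gt0.
have pB s : p *m B s = (1 - a s * al) *: p + (a s * be) *: r.
  rewrite /B mulmxBr mulmx1 -scalemxAr pH scalerBr !scalerA scalerBl scale1r opprB.
  by rewrite addrCA addrC.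
have rB s : r *m B s = (1 - a s * al) *: r - (a s * be) *: p.
  rewrite /B mulmxBr mulmx1 -scalemxAr rH scalerDr !scalerA scalerBl scale1r opprD.
  by rewrite addrA addrAC.
have step s : (s1 <= s)%N ->
    ((1 - a s * al) ^+ 2 + (a s * be) ^+ 2) * (qform (S s) p + qform (S s) r) +
    k * (qform 1%:M p + qform 1%:M r) * a s ^+ 2 <=
    qform (S s.+1) p + qform (S s.+1) r.
  move=> s1s; rewrite !qformS pB rB addrACA qform_rot lerD2l -mulrDr.
  rewrite mulrC ler_wpM2l ?sqr_ge0// mulrDr lerD//.
    by apply: le_trans (N_ge s p); rewrite mulrC ler_wpM2l// hk.
  by apply: le_trans (N_ge s r); rewrite mulrC ler_wpM2l// hk.
exists (k * (qform 1%:M p + qform 1%:M r)); first exact: mulr_gt0.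
have W0 s : 0 <= qform (S s) p + qform (S s) r by rewrite addr_ge0.
exists (maxn s0 s1); split=> s; rewrite geq_max => /andP[s0s s1s].
- apply: le_trans (step s s1s); rewrite lerD2r ler_wpM2r//.
  have := sqr_ge0 (a s * al); have := sqr_ge0 (a s * be); lra.
- by apply: le_trans (step s s1s); rewrite lerDr mulr_ge0// addr_ge0 ?sqr_ge0.
- have [e e0 he] := nd s s0s.
  by apply: lt_le_trans (lerD (he p) (he r)); rewrite -mulrDr mulr_gt0.
Qed.

Lemma no_opposite_eigenvalues (p1 r1 p2 r2 : 'rV[R]_n) al1 be1 al2 be2 :
  (p1 != 0) || (r1 != 0) -> (p2 != 0) || (r2 != 0) ->
  p1 *m H = al1 *: p1 - be1 *: r1 -> r1 *m H = be1 *: p1 + al1 *: r1 ->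
  p2 *m H = al2 *: p2 - be2 *: r2 -> r2 *m H = be2 *: p2 + al2 *: r2 ->
  al1 <= 0 -> 0 <= al2 -> False.
Proof.
move=> n1 n2 e1 f1 e2 f2 al10 al20.
have [k kp [s [g1 g2 g3]]] := growth n1 e1 f1.
have [k' kp' [s' [g1' g2' g3']]] := growth n2 e2 f2.
have W0 (p r : 'rV[R]_n) : qform (S s) p + qform (S s) r @[s --> \oo] --> (0 : R).
  by rewrite -[X in _ --> X]addr0; apply: cvgD; exact: cvg_qform.
have mk t : Num.min k k' * a t ^+ 2 <= k * a t ^+ 2.
  by rewrite ler_wpM2r ?sqr_ge0// ge_min lexx.
have mk' t : Num.min k k' * a t ^+ 2 <= k' * a t ^+ 2.
  by rewrite ler_wpM2r ?sqr_ge0// ge_min lexx orbT.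
apply: (@opposite_growth _ _ _ a al1 al2 (Num.min k k') (maxn s s') _ al10 al20
   _ _ _ _ _ _ (W0 p1 r1) (W0 p2 r2)).
- by rewrite lt_min kp kp'.
- move=> t; rewrite geq_max => /andP[st _]; apply: le_trans (g1 t st).
  by rewrite lerD2l.
- move=> t; rewrite geq_max => /andP[_ st]; apply: le_trans (g1' t st).
  by rewrite lerD2l.
- by move=> t; rewrite geq_max => /andP[st _]; exact: le_trans (g2 t st).
- by move=> t; rewrite geq_max => /andP[_ st]; exact: le_trans (g2' t st).
- by move=> t; rewrite geq_max => /andP[st _]; exact: g3.
- by move=> t; rewrite geq_max => /andP[_ st]; exact: g3'.
Qed.

End unstable.

(** * Lyapunov functions *)

Section real_schur.
Context {R : realType} {n : nat}.

Lemma Re_mulmx m p k (A : 'M[R[i]]_(m, p)) (B : 'M[R[i]]_(p, k)) :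
  map_mx (@complex.Re R) (A *m B) =
  map_mx (@complex.Re R) A *m map_mx (@complex.Re R) B -
  map_mx (@complex.Im R) A *m map_mx (@complex.Im R) B.
Proof.
apply/matrixP => i j; rewrite !mxE (raddf_sum (@complex.Re R : Rcomplex R -> R)) -sumrB.
by apply: eq_bigr => l _; rewrite !mxE; case: (A i l) => ? ?; case: (B l j) => ? ?.
Qed.

Lemma Im_mulmx m p k (A : 'M[R[i]]_(m, p)) (B : 'M[R[i]]_(p, k)) :
  map_mx (@complex.Im R) (A *m B) =
  map_mx (@complex.Im R) A *m map_mx (@complex.Re R) B +
  map_mx (@complex.Re R) A *m map_mx (@complex.Im R) B.
Proof.
apply/matrixP => i j; rewrite !mxE (raddf_sum (@complex.Im R : Rcomplex R -> R)) -big_split.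
apply: eq_bigr => l _; rewrite !mxE; case: (A i l) => ? ?; case: (B l j) => ? ? /=; ring.
Qed.

Lemma Re_map_real m p (A : 'M[R]_(m, p)) : map_mx (@complex.Re R) (map_mx (real_complex R) A) = A.
Proof. by apply/matrixP => i j; rewrite !mxE. Qed.

Lemma Im_map_real m p (A : 'M[R]_(m, p)) : map_mx (@complex.Im R) (map_mx (real_complex R) A) = 0.
Proof. by apply/matrixP => i j; rewrite !mxE. Qed.

(** Real and imaginary parts of a complex Schur form [U H = T U], with [U = p + i q] unitary and
    [T = al + i be] lower triangular; the third clause is the real part of [U^* U = 1]. *)
Lemma real_schur (H : 'M[R]_n) : (0 < n)%N -> exists p q al be : 'M[R]_n,
  [/\ p *m H = al *m p - be *m q, q *m H = be *m p + al *m q,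
      p^T *m p + q^T *m q = 1%:M,
      (forall i j : 'I_n, (i < j)%N -> al i j = 0 /\ be i j = 0) &
      forall i, exists b, eigenvalue (map_mx (real_complex R) H) (Complex (al i i) b)].
Proof.
move=> n0; have [U Uu] := Schur (map_mx (real_complex R) H) n0.
set Hc := map_mx _ H; have Uunit := unitarymx_unit Uu.
rewrite /similar_to conjumx// => /is_trig_mxP Ttrig; set Tr := _ *m invmx U in Ttrig.
have UH : U *m Hc = Tr *m U by rewrite /Tr mulmxKV.
exists (map_mx (@complex.Re R) U), (map_mx (@complex.Im R) U),
  (map_mx (@complex.Re R) Tr), (map_mx (@complex.Im R) Tr); split.
- have := congr1 (map_mx (@complex.Re R)) UH.
  by rewrite !Re_mulmx Re_map_real Im_map_real mulmx0 subr0.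
- have := congr1 (map_mx (@complex.Im R)) UH.
  by rewrite !Im_mulmx Re_map_real Im_map_real mulmx0 addr0.
- have UV := mulVmx Uunit; rewrite invmx_unitary// in UV.
  apply/matrixP => k l; have := congr1 (fun M : 'M[R[i]]_n => complex.Re (M k l)) UV.
  rewrite !mxE (raddf_sum (@complex.Re R : Rcomplex R -> R)) -big_split/= => h.
  transitivity (complex.Re ((k == l)%:R : R[i])); last by case: (k == l).
  rewrite -h; apply: eq_bigr => i _; rewrite !mxE.
  by case: (U i k) => ? ?; case: (U i l) => ? ? /=; ring.
- by move=> i j ij; split; rewrite mxE (Ttrig _ _ ij).
- move=> i; exists (complex.Im (Tr i i)).
  have -> : Complex (map_mx (@complex.Re R) Tr i i) (complex.Im (Tr i i)) = Tr i i.
    by rewrite mxE; case: (Tr i i).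
  have stU : stablemx U Hc by rewrite submx_full// row_full_unit.
  have TrE : conjmx U Hc = Tr by rewrite conjumx.
  apply: (eigenvalue_conjmx stU); first by rewrite row_free_unit.
  rewrite TrE -topredE/= eigenvalue_root_char char_poly_trig; last exact/is_trig_mxP.
  by apply/rootP; rewrite horner_prod (bigD1 i)//= hornerXsubC subrr mul0r.
Qed.
End real_schur.

Section semi_inner_product.
Context {R : realFieldType} {n : nat}.
Implicit Types (S : 'M[R]_n) (v w : 'rV[R]_n).

Definition bform S v w : R := (v *m S *m w^T) ord0 ord0.

Lemma bformvv S v : bform S v v = qform S v. Proof. by []. Qed.

Lemma bformC S v w : S^T = S -> bform S v w = bform S w v.
Proof.
move=> Ssym; rewrite /bform; have <- : (w *m S *m v^T)^T = v *m S *m w^T.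
  by rewrite !trmx_mul trmxK Ssym mulmxA.
by rewrite mxE.
Qed.

Lemma bformDr S v w w' : bform S v (w + w') = bform S v w + bform S v w'.
Proof. by rewrite /bform linearD/= mulmxDr mxE. Qed.

Lemma bformDl S v v' w : bform S (v + v') w = bform S v w + bform S v' w.
Proof. by rewrite /bform !mulmxDl mxE. Qed.

Lemma bformZr S c v w : bform S v (c *: w) = c * bform S v w.
Proof. by rewrite /bform linearZ/= -scalemxAr mxE. Qed.

Lemma bformZl S c v w : bform S (c *: v) w = c * bform S v w.
Proof. by rewrite /bform -!scalemxAl mxE. Qed.

Lemma bform_sumr S v (I : Type) (r : seq I) (F : I -> 'rV[R]_n) :
  bform S v (\sum_(i <- r) F i) = \sum_(i <- r) bform S v (F i).
Proof.
elim: r => [|i r ih]; first by rewrite !big_nil /bform trmx0 mulmx0 mxE.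
by rewrite !big_cons bformDr ih.
Qed.

Lemma qformD S v w : S^T = S -> qform S (v + w) = qform S v + 2 * bform S v w + qform S w.
Proof.
by move=> Ssym; rewrite -!bformvv bformDl !bformDr (bformC w v Ssym); ring.
Qed.

Lemma qformZ S c v : qform S (c *: v) = c ^+ 2 * qform S v.
Proof. by rewrite -!bformvv bformZl bformZr mulrA expr2. Qed.

(** Positivity of the form at [th v + c w], divided by [th]. *)
Lemma young S v w c th : S^T = S -> (forall v, 0 <= qform S v) -> 0 < th ->
  - (th * qform S v) - c ^+ 2 / th * qform S w <= 2 * (c * bform S v w).
Proof.
move=> Ssym Sp th0; have := Sp (th *: v + c *: w).
rewrite qformD// !qformZ bformZl bformZr => h.
rewrite -(ler_pM2r th0) mulrBl mulrAC divfK ?gt_eqF//; lra.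
Qed.

End semi_inner_product.

(** * A weighted sum of the form over the Schur vectors, decreasing under the dynamics *)

Section lyapunov.
Context {R : realType} {n : nat}.
Variables (H p q al be : 'M[R]_n) (mu : R).
Hypothesis n0 : (0 < n)%N.
Hypothesis pH : p *m H = al *m p - be *m q.
Hypothesis qH : q *m H = be *m p + al *m q.
Hypothesis pq1 : p^T *m p + q^T *m q = 1%:M.
Hypothesis trig : forall i j : 'I_n, (i < j)%N -> al i j = 0 /\ be i j = 0.
Hypothesis mu0 : 0 < mu.
Hypothesis mu_le : forall i, mu <= al i i.

Let G S (i : 'I_n) : R := qform S (row i p) + qform S (row i q).
Let M : R := \sum_i \sum_j (al i j ^+ 2 + be i j ^+ 2).
(** The diagonal offers a decay of [2 mu], of which [mu] is to be kept. [th] is the Young parameter,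
    with [2 th n = mu / 2]; [r] is chosen so that [n r M / th <= mu / 2], the term [mu th] in its
    denominator giving [r <= 1]. Here [mu] is a real number bounding the real parts of the
    eigenvalues from below. *)
Let th : R := mu / (4 * n%:R).
Let r : R := mu * th / (2 * n%:R * (M + 1) + mu * th).

Definition lyapunov_form S : R := \sum_(i < n) r ^+ i * G S i.

Let nR0 : 0 < n%:R :> R. Proof. by rewrite ltr0n. Qed.

Let M0 : 0 <= M.
Proof.
by apply: sumr_ge0 => i _; apply: sumr_ge0 => j _; rewrite addr_ge0 ?sqr_ge0.
Qed.

Let th0 : 0 < th. Proof. by rewrite divr_gt0// mulr_gt0. Qed.

Let r_den : 0 < 2 * n%:R * (M + 1) + mu * th.
Proof.
have M1 : 0 < M + 1 by have := M0; lra.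
by apply: addr_gt0; apply: mulr_gt0 => //; apply: mulr_gt0.
Qed.

Let r0 : 0 < r. Proof. by rewrite divr_gt0// mulr_gt0. Qed.

Let r1 : r <= 1.
Proof.
rewrite ler_pdivrMr// mul1r lerDr.
apply: mulr_ge0; [exact: mulr_ge0 | exact: addr_ge0].
Qed.

Let rM : n%:R * r * (M / th) <= mu / 2.
Proof.
have : r * (2 * n%:R * (M + 1) + mu * th) = mu * th by rewrite /r divfK ?gt_eqF.
move=> h; rewrite mulrA ler_pdivrMr//.
have := mulr_ge0 (ltW r0) (ltW nR0); have := mulr_gt0 r0 (mulr_gt0 mu0 th0); lra.
Qed.

Let entry_M i j : al i j ^+ 2 + be i j ^+ 2 <= M.
Proof.
rewrite /M (bigD1 i)//= (bigD1 j)//= -addrA lerDl addr_ge0// sumr_ge0// => k _.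
  by rewrite addr_ge0 ?sqr_ge0.
by apply: sumr_ge0 => l _; rewrite addr_ge0 ?sqr_ge0.
Qed.

Let rowpH i : row i p *m H = \sum_j (al i j *: row j p + (- be i j) *: row j q).
Proof.
rewrite -row_mul pH; apply/rowP => k; rewrite !mxE summxE -sumrB.
by apply: eq_bigr => j _; rewrite !mxE mulNr.
Qed.

Let rowqH i : row i q *m H = \sum_j (be i j *: row j p + al i j *: row j q).
Proof.
rewrite -row_mul qH; apply/rowP => k; rewrite !mxE summxE -big_split.
by apply: eq_bigr => j _; rewrite !mxE.
Qed.

Section fixed_form.
Variable S : 'M[R]_n.
Hypothesis Ssym : S^T = S.
Hypothesis Sp : forall v, 0 <= qform S v.

Let G0 i : 0 <= G S i. Proof. by rewrite addr_ge0. Qed.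

(** Real part of the Hermitian product of the [i]-th Schur vector with its image under [H]; in one
    step of gain [a], [G S i] loses [2 a cross i] to first order. *)
Definition cross i : R := bform S (row i p) (row i p *m H) + bform S (row i q) (row i q *m H).

(** By triangularity the image of the [i]-th vector involves only the vectors [j <= i]. Each [j < i]
    contributes four mixed products, which Young's inequality splits into [2 th G S i] and at most
    [M / th * G S j]. *)
Let cross_ge i : (2 * mu - 2 * th * n%:R) * G S i -
  \sum_(j < n) (if (j < i)%N then M / th * G S j else 0) <= 2 * cross i.
Proof.
rewrite /cross rowpH rowqH !bform_sumr -big_split/= mulr_sumr.
have -> : (2 * mu - 2 * th * n%:R) * G S i = \sum_(j < n)
    ((if j == i then 2 * mu * G S i else 0) - 2 * th * G S i).
  rewrite sumrB sumr_const card_ord -big_mkcond big_pred1_eq -mulr_natr; ring.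
rewrite -sumrB; apply: ler_sum => j _.
rewrite !bformDr !bformZr.
case: (ltngtP j i) => [ji|ij|/val_inj ->].
- rewrite (_ : (j == i) = false) ?sub0r; last by apply/eqP => e; move: ji; rewrite e ltnn.
  have := young (row i p) (row j p) (al i j) Ssym Sp th0.
  have := young (row i q) (row j q) (al i j) Ssym Sp th0.
  have := young (row i q) (row j p) (be i j) Ssym Sp th0.
  have := young (row i p) (row j q) (- be i j) Ssym Sp th0.
  have : (al i j ^+ 2 + be i j ^+ 2) / th * G S j <= M / th * G S j.
    by rewrite ler_wpM2r// ler_pM2r ?invr_gt0.
  rewrite /G; lra.
- have [-> ->] := trig ij.
  rewrite (_ : (j == i) = false); last by apply/eqP => e; move: ij; rewrite e ltnn.
  have := mulr_ge0 (ltW th0) (G0 i); lra.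
(* The two terms in [be i i] cancel by symmetry of [S], leaving [2 al i i G S i]. *)
- rewrite eqxx (bformC (row i q) (row i p) Ssym) !bformvv.
  have := ler_wpM2r (G0 i) (mu_le i); have := mulr_ge0 (ltW th0) (G0 i).
  rewrite /G; lra.
Qed.

Lemma drift : mu * lyapunov_form S <= 2 * \sum_(i < n) r ^+ i * cross i.
Proof.
have rge0 i : 0 <= r ^+ i by rewrite exprn_ge0// ltW.
apply: (@le_trans _ _ (\sum_(i < n) r ^+ i * ((2 * mu - 2 * th * n%:R) * G S i -
    \sum_(j < n) (if (j < i)%N then M / th * G S j else 0)))); last first.
  by rewrite [leRHS]mulr_sumr; apply: ler_sum => i _; rewrite [leRHS]mulrCA ler_wpM2l.
have thn : 2 * th * n%:R = mu / 2 by rewrite /th; field; rewrite gt_eqF.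
have off : \sum_(i < n) r ^+ i * \sum_(j < n) (if (j < i)%N then M / th * G S j else 0) <=
    mu / 2 * lyapunov_form S.
  under eq_bigr do rewrite mulr_sumr.
  rewrite exchange_big/= mulr_sumr; apply: ler_sum => j _.
  have MG : 0 <= M / th * G S j by apply: mulr_ge0 => //; apply: divr_ge0 => //; exact: ltW.
  (* The purpose of the weights: what [i] charges to a [j < i] has weight [r ^+ i <= r * r ^+ j],
     smaller by a factor [r] than the weight of [G S j] itself. *)
  apply: (@le_trans _ _ (\sum_(i < n) r * r ^+ j * (M / th * G S j))).
    apply: ler_sum => i _; case: ifP => ji; last first.
      by rewrite mulr0; apply: mulr_ge0 => //; rewrite -exprS exprn_ge0// ltW.
    rewrite ler_wpM2r// -exprS.
    by rewrite ler_wiXn2l// ltW.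
  rewrite sumr_const card_ord -[leLHS]mulr_natl.
  rewrite (_ : n%:R * _ = n%:R * r * (M / th) * (r ^+ j * G S j)); last by ring.
  by rewrite ler_wpM2r// mulr_ge0.
under eq_bigr do rewrite mulrBr mulrCA.
rewrite sumrB -mulr_sumr -/(lyapunov_form S) thn; lra.
Qed.

Lemma trace_lyapunov : \tr S = \sum_(i < n) (qform S (row i p) + qform S (row i q)).
Proof.
have -> : \tr S = \tr (S *m (p^T *m p + q^T *m q)) by rewrite pq1 mulmx1.
have trS (A : 'M[R]_n) : \tr (S *m (A^T *m A)) = \sum_(i < n) qform S (row i A).
  rewrite mulmxA mxtrace_mulC mulmxA; apply: eq_bigr => i _.
  by rewrite /qform -row_mul tr_row !mxE; apply: eq_bigr => k _; rewrite !mxE.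
by rewrite mulmxDr linearD/= !trS -big_split.
Qed.

Lemma lyapunov_ge0 : 0 <= lyapunov_form S.
Proof. by apply: sumr_ge0 => i _; rewrite mulr_ge0// exprn_ge0// ltW. Qed.

End fixed_form.

Lemma trace_le_lyapunov : exists2 C, 0 <= C &
  forall S, (forall v, 0 <= qform S v) -> \tr S <= C * lyapunov_form S.
Proof.
exists (r ^- n) => [|S Sp]; first by rewrite invr_ge0 exprn_ge0// ltW.
rewrite trace_lyapunov mulrC ler_pdivlMr ?exprn_gt0// mulr_suml; apply: ler_sum => i _.
rewrite [leLHS]mulrC ler_wpM2r//; first exact: addr_ge0.
by apply: ler_wiXn2l; [exact: ltW | exact: r1 | exact: ltnW].
Qed.

Lemma lyapunov_formDZ (S N : 'M[R]_n) c :
  lyapunov_form (S + c *: N) = lyapunov_form S + c * lyapunov_form N.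
Proof.
rewrite mulr_sumr -big_split/=; apply: eq_bigr => i _.
rewrite /G /qform !mulmxDr !mulmxDl -!scalemxAr -!scalemxAl.
have E (k : R) (A B : 'M[R]_1) : (A + k *: B) ord0 ord0 = A ord0 ord0 + k * B ord0 ord0.
  by rewrite !mxE.
by rewrite !E; ring.
Qed.

Lemma weighted_le_trace (S : 'M[R]_n) (f g : 'I_n -> 'rV[R]_n) :
  (forall v, 0 <= qform S v) ->
  \sum_(i < n) r ^+ i * (qform S (f i) + qform S (g i)) <=
  n%:R * (\sum_(i < n) (qform 1%:M (f i) + qform 1%:M (g i))) * \tr S.
Proof.
move=> Sp; rewrite [X in _ <= X * _]mulr_sumr mulr_suml; apply: ler_sum => i _.
apply: (@le_trans _ _ (qform S (f i) + qform S (g i))).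
  rewrite ler_piMl ?addr_ge0// exprn_ile1//; exact: ltW.
by rewrite mulrDr mulrDl lerD// qform_le_trace.
Qed.

(** The left side is a quadratic polynomial in [a]: the drift controls its linear coefficient, the
    trace its quadratic one. *)
Lemma lyapunov_step (S : 'M[R]_n) (a : R) : S^T = S -> (forall v, 0 <= qform S v) -> 0 <= a ->
  lyapunov_form ((1%:M - a *: H) *m S *m (1%:M - a *: H)^T) <=
  (1 - a * mu) * lyapunov_form S + a ^+ 2 *
    (n%:R * (\sum_(i < n) (qform 1%:M (row i p *m H) + qform 1%:M (row i q *m H))) * \tr S).
Proof.
move=> Ssym Sp a0.
have qB v : qform ((1%:M - a *: H) *m S *m (1%:M - a *: H)^T) v =
    qform S v - 2 * a * bform S v (v *m H) + a ^+ 2 * qform S (v *m H).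
  have := qform_step (1%:M - a *: H) S 0 0 v; rewrite scale0r addr0 mul0r addr0 => ->.
  rewrite mulmxBr mulmx1 -scalemxAr -scaleNr qformD// qformZ sqrrN bformZr; ring.
have -> : lyapunov_form ((1%:M - a *: H) *m S *m (1%:M - a *: H)^T) =
    lyapunov_form S - a * (2 * \sum_(i < n) r ^+ i * cross S i) +
    a ^+ 2 * \sum_(i < n) r ^+ i * (qform S (row i p *m H) + qform S (row i q *m H)).
  rewrite !mulr_sumr -sumrB -big_split/=; apply: eq_bigr => i _.
  by rewrite /G !qB /cross; ring.
rewrite lerD//; last by rewrite ler_wpM2l ?sqr_ge0// weighted_le_trace.
have := ler_wpM2l a0 (drift Ssym Sp); lra.
Qed.

End lyapunov.

Lemma lyapunov (R : realType) (n : nat) (H : 'M[R]_n) : (0 < n)%N ->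
  (forall z, eigenvalue (map_mx (real_complex R) H) z -> 0 < complex.Re z) ->
  exists (L : 'M[R]_n -> R) (mu C : R), [/\ 0 < mu, 0 <= C,
    forall S N c, L (S + c *: N) = L S + c * L N,
    forall S, (forall v, 0 <= qform S v) ->
      [/\ 0 <= L S, \tr S <= C * L S & L S <= C * \tr S] &
    forall S a, S^T = S -> (forall v, 0 <= qform S v) -> 0 <= a ->
      L ((1%:M - a *: H) *m S *m (1%:M - a *: H)^T) <= (1 - a * mu + a ^+ 2 * C) * L S].
Proof.
move=> n0 eigH; have [p [q [al [be [pH qH pq1 trig eig]]]]] := real_schur H n0.
have al0 i : 0 < al i i by have [b /eigH] := eig i.
(* The seed 1 merely caps the minimum; only positivity and [mu <= al i i] matter. *)
pose mu := \big[Num.min/1]_(i < n) al i i.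
have mu0 : 0 < mu by apply: lt_bigmin.
have mu_le i : mu <= al i i by exact: bigmin_le_cond.
have [C1 C10 h1] := @trace_le_lyapunov _ _ p q al be mu n0 pq1 mu0.
pose L := lyapunov_form p q al be mu.
pose C2 := n%:R * \sum_(i < n) (qform 1%:M (row i p) + qform 1%:M (row i q)).
pose C3 := n%:R * \sum_(i < n) (qform 1%:M (row i p *m H) + qform 1%:M (row i q *m H)).
have q1_ge0 (v : 'rV[R]_n) : 0 <= qform 1%:M v.
  by rewrite qform1 sumr_ge0// => k _; exact: sqr_ge0.
have C20 : 0 <= C2 by apply: mulr_ge0 => //; apply: sumr_ge0 => i _; exact: addr_ge0.
have C30 : 0 <= C3 by apply: mulr_ge0 => //; apply: sumr_ge0 => i _; exact: addr_ge0.
have trS0 (S : 'M[R]_n) : (forall v, 0 <= qform S v) -> 0 <= \tr S.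
  by move=> Sp; rewrite (trace_lyapunov pq1 S); apply: sumr_ge0 => i _; exact: addr_ge0.
have L0 S : (forall v, 0 <= qform S v) -> 0 <= L S by exact: lyapunov_ge0.
exists L, mu, (C1 + C2 + C3 * C1); split => //.
- by rewrite !addr_ge0// mulr_ge0.
- by move=> S N c; exact: lyapunov_formDZ.
- move=> S Sp; have S0 := L0 S Sp; have t0 := trS0 S Sp; split=> //.
    apply: (le_trans (h1 S Sp)); rewrite -addrA mulrDl lerDl mulr_ge0// addr_ge0// mulr_ge0//.
  apply: (le_trans (weighted_le_trace al be n0 mu0 (fun i => row i p) (fun i => row i q) Sp)).
  rewrite -/C2.
  rewrite -addrA mulrDl mulrDl addrCA lerDl addr_ge0// mulr_ge0// mulr_ge0//.
- move=> S a Ssym Sp a0; apply: (le_trans (lyapunov_step n0 pH qH trig mu0 mu_le Ssym Sp a0)).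
  rewrite -/C3 [leRHS]mulrDl lerD2l -[leRHS]mulrA; apply: ler_wpM2l; first exact: sqr_ge0.
  apply: (@le_trans _ _ (C3 * (C1 * L S))); first by rewrite ler_wpM2l// h1.
  by rewrite mulrA [leRHS]mulrDl lerDr mulr_ge0 ?L0// addr_ge0.
Qed.

(** * Spectral abscissae *)

(** From an index [s0 > D] on, [s V s] stays below [C]. The three units of decay are spent as
    follows: one absorbs the perturbation [D / (s + 1)^2] of the factor, one the growth of the
    weight from [s] to [s + 1], and one pays for the additive term, since [D <= C]. *)
Lemma recursion_cvg0 (R : realType) (V : nat -> R) (D : R) : 0 <= D ->
  (forall s, 0 <= V s) ->
  (forall s, V s.+1 <= (1 - 3 / s.+1%:R + D / s.+1%:R ^+ 2) * V s + D / s.+1%:R ^+ 2) ->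
  V s @[s --> \oo] --> (0 : R).
Proof.
move=> D0 V0 rec; pose s0 := (Num.truncn D).+1.
have Ds0 : D < s0%:R by exact: truncnS_gt.
pose C := D + s0%:R * V s0.
have C0 : 0 <= C by rewrite addr_ge0// mulr_ge0.
have bnd k : (s0 + k)%:R * V (s0 + k)%N <= C.
  elim: k => [|k ih]; first by rewrite addn0 lerDr.
  rewrite addnS; move: ih; have := rec (s0 + k)%N; have := V0 (s0 + k)%N.
  have : 1 <= (s0 + k)%:R :> R by rewrite ler1n addSn.
  have : D <= (s0 + k)%:R by rewrite (le_trans (ltW Ds0))// ler_nat leq_addr.
  have : D <= C by rewrite lerDl mulr_ge0.
  rewrite -[(s0 + k).+1%:R]natr1; move: (V (s0 + k)%N) (V (s0 + k).+1) ((s0 + k)%:R : R).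
  move=> v v' t DC Dt t1 v0 h ih.
  have t0 : 0 < t by lra.
  have tt0 : 0 < t + 1 by lra.
  have h2 : (t + 1) * v' <= (t - 1) * v + D / (t + 1).
    have e1 : D / (t + 1) ^+ 2 <= (t + 1)^-1.
      by rewrite ler_pdivrMr ?exprn_gt0// expr2 mulKf ?gt_eqF//; lra.
    apply: (le_trans (ler_wpM2l (ltW tt0) h)).
    have -> : (t + 1) * ((1 - 3 / (t + 1) + D / (t + 1) ^+ 2) * v + D / (t + 1) ^+ 2) =
      (t - 2) * v + (t + 1) * (D / (t + 1) ^+ 2) * v + D / (t + 1) by field; rewrite gt_eqF.
    have : (t + 1) * (D / (t + 1) ^+ 2) <= 1.
      by apply: (le_trans (ler_wpM2l (ltW tt0) e1)); rewrite divff// lt0r_neq0.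
    by move=> /(ler_wpM2r v0); lra.
  have h3 : t * ((t - 1) * v + D / (t + 1)) <= t * C.
    have : (t - 1) * (t * v) <= (t - 1) * C by rewrite ler_wpM2l//; lra.
    have : t * (D / (t + 1)) <= D.
      by rewrite mulrA ler_pdivrMr//; have := mulr_ge0 D0 (ltW t0); lra.
    lra.
  by apply: (le_trans h2); rewrite -(ler_pM2l t0).
rewrite -(cvg_shiftn s0).
apply: (@squeeze_cvgr _ _ _ _ (cst 0) (fun k => C * harmonic k)).
- near=> k; rewrite V0/= addnC /harmonic /= ler_pdivlMr// mulrC.
  apply: le_trans (bnd k); rewrite ler_wpM2r// ler_nat; exact: leq_addl.
- exact: cvg_cst.
- by rewrite -(mulr0 C); apply: cvgM; [exact: cvg_cst | exact: cvg_harmonic].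
Unshelve. all: end_near. Qed.

Section spectrum.
Context {R : realType} {n : nat}.
Variable A : 'M[R]_n.
Hypothesis n0 : (0 < n)%N.

(** The real parts of the roots of the characteristic polynomial, of degree [n > 0]; the form
    [x :: s] records that there is at least one. *)
Lemma re_eigenvalues_seq : exists x (s : seq R), re_eigenvalues A = [set` x :: s].
Proof.
have [r rE] := closed_field_poly_normal (char_poly (map_mx (real_complex R) A)).
rewrite (monicP (char_poly_monic _)) scale1r in rE.
have eigE z : eigenvalue (map_mx (real_complex R) A) z = (z \in r).
  by rewrite eigenvalue_root_char rE root_prod_XsubC.
have : size r != 0%N.
  have := congr1 (fun p : {poly R[i]} => size p) rE.
  rewrite size_char_poly size_prod_XsubC => -[<-].
  by rewrite -lt0n.
case: r rE eigE => // z r _ eigE _.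
exists (complex.Re z), [seq complex.Re z | z <- r].
apply/seteqP; split=> [_ [y /= yr <-]|y /=].
  by rewrite eigE in yr; exact: (map_f (@complex.Re R) yr).
rewrite -/(map _ (z :: r)) => /mapP[y' y'r ->].
by exists y' => //=; rewrite eigE.
Qed.

Lemma seq_max (x : R) (s : seq R) :
  exists2 m, m \in x :: s & forall y, y \in x :: s -> y <= m.
Proof.
elim: s x => [|y s ih] x; first by exists x; rewrite ?mem_head// => y; rewrite inE => /eqP ->.
have [m ms mmax] := ih y; have [xm|mx] := leP x m.
  exists m; first by rewrite inE ms orbT.
  by move=> z; rewrite inE => /predU1P[->//|/mmax].
exists x; first exact: mem_head.
by move=> z; rewrite inE => /predU1P[->//|/mmax /le_trans]; apply; exact: ltW.
Qed.

Lemma rho_max_attained :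
  re_eigenvalues A (rho_max A) /\ forall y, re_eigenvalues A y -> y <= rho_max A.
Proof.
have [x [s E]] := re_eigenvalues_seq; rewrite /rho_max E.
have [m ms mmax] := seq_max x s.
have ub : ubound [set` x :: s] m by move=> y /= /mmax.
have -> : sup [set` x :: s] = m.
  apply/eqP; rewrite eq_le ge_sup//=; last by exists m.
  by apply: ub_le_sup => //; exists m.
by split=> // y /= /mmax.
Qed.

Lemma rho_min_attained :
  re_eigenvalues A (rho_min A) /\ forall y, re_eigenvalues A y -> rho_min A <= y.
Proof.
have [x [s E]] := re_eigenvalues_seq; rewrite /rho_min E.
have [m ms mmax] := seq_max (- x) [seq - y | y <- s].
have memN y : (y \in x :: s) = (- y \in - x :: [seq - y | y <- s]).
  by rewrite -map_cons (mem_map oppr_inj).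
have mm : - m \in x :: s by rewrite memN opprK.
have lb : lbound [set` x :: s] (- m).
  by move=> y /=; rewrite memN => /mmax; rewrite lerNl.
have -> : inf [set` x :: s] = - m.
  apply/eqP; rewrite eq_le lb_le_inf//=; last by exists (- m).
  by rewrite andbT; apply: ge_inf => //; exists (- m).
by split=> // y /lb.
Qed.

Lemma real_eigenpair z : eigenvalue (map_mx (real_complex R) A) z ->
  exists p r : 'rV[R]_n, [/\ (p != 0) || (r != 0),
    p *m A = complex.Re z *: p - complex.Im z *: r &
    r *m A = complex.Im z *: p + complex.Re z *: r].
Proof.
move=> /eigenvalueP[v vA v0].
exists (map_mx (@complex.Re R) v), (map_mx (@complex.Im R) v); split.
- apply: contraNT v0; rewrite negb_or !negbK => /andP[/eqP p0 /eqP r0].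
  apply/eqP/rowP => j; have /rowP/(_ j) := p0; have /rowP/(_ j) := r0.
  by rewrite !mxE; case: (v ord0 j) => ? ? /= -> ->.
- have := congr1 (map_mx (@complex.Re R)) vA.
  rewrite Re_mulmx Re_map_real Im_map_real mulmx0 subr0 => ->.
  by apply/rowP => j; rewrite !mxE; case: z {vA} => ? ?; case: (v ord0 j).
- have := congr1 (map_mx (@complex.Im R)) vA.
  rewrite Im_mulmx Re_map_real Im_map_real mulmx0 addr0 => ->.
  apply/rowP => j; rewrite !mxE; case: z {vA} => ? ?; case: (v ord0 j) => ? ? /=; ring.
Qed.

Lemma eigenvalue_affine (e : R) z : e != 0 ->
  eigenvalue (map_mx (real_complex R) (e *: (1%:M - A))) z ->
  eigenvalue (map_mx (real_complex R) A) (1 - (real_complex R e)^-1 * z).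
Proof.
move=> e0 /eigenvalueP[v vA v0]; apply/eigenvalueP; exists v => //.
move: vA; rewrite map_mxZ map_mxB map_mx1 -scalemxAr mulmxBr mulmx1 => h.
have ec0 : real_complex R e != 0 by rewrite fmorph_eq0.
have := congr1 (fun w => (real_complex R e)^-1 *: w) h.
rewrite scalerA mulVf// scale1r scalerA scalerBl scale1r => <-.
by rewrite subKr.
Qed.

End spectrum.

(** * The theorem *)

Section mean_square_convergence.
Context {R : realType} {d : measure_display} {T : measurableType d} {n : nat}.
Variables (mu : probability T R) (a : nat -> R).
Variables (P : nat -> T -> 'M[R]_n) (u : nat -> T -> 'cV[R]_n).
Variables (x0 : 'cV[R]_n) (Pbar : 'M[R]_n) (ubar : 'cV[R]_n).
Let x := trajectory a P u x0.
Hypothesis hP : forall s i j, measurable_fun setT (fun w => P s w i j).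
Hypothesis hu : forall s i, measurable_fun setT (fun w => u s w i ord0).
Hypothesis hA1 : A1 mu P u x Pbar ubar.

Lemma mean_square_sufficient (e C lam : R) (L : 'M[R]_n -> R) (b : 'cV[R]_n) :
  0 < lam -> 0 <= C -> e ^+ 2 = 1 ->
  (forall s, a s = e * (3 / lam / s.+1%:R)) ->
  (forall S N c, L (S + c *: N) = L S + c * L N) ->
  (forall S, (forall v, 0 <= qform S v) ->
     [/\ 0 <= L S, \tr S <= C * L S & L S <= C * \tr S]) ->
  (forall S t, S^T = S -> (forall v, 0 <= qform S v) -> 0 <= t ->
     L ((1%:M - t *: (e *: (1%:M - Pbar))) *m S *m (1%:M - t *: (e *: (1%:M - Pbar)))^T) <=
     (1 - t * lam + t ^+ 2 * C) * L S) ->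
  (1%:M - Pbar) *m b = ubar ->
  cvg_mean_square mu x b.
Proof.
move=> lam0 C0 e2 aE Llin Lpsd Lstep bE; apply/(cvg_mean_squareE hP hu hA1).
have [K K0 hK] := noise_moment_le hP hu hA1.
pose V s := second_moment mu a P u x0 s b.
have Vpsd s v : 0 <= qform (V s) v by exact: (second_moment_ge0 hP hu hA1).
have Npsd s v : 0 <= qform (noise_moment mu a P u x0 Pbar ubar s) v.
  by apply: mixed_moment_ge0; exact: (sqint_vec_noise hP hu hA1).
have b2 : 0 <= \sum_j b j ord0 ^+ 2 by apply: sumr_ge0 => j _; exact: sqr_ge0.
pose t s : R := 3 / lam / s.+1%:R.
have t0 s : 0 <= t s by rewrite !divr_ge0// ltW.
(* The noise is bounded through the second moment about 0, whereas the recursion follows the one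
   about [b]; the bias-variance decomposition at both centers links them. *)
have q_le s : sqr_mean mu a P u x0 s 0 <= 2 * \tr (V s) + 2 * \sum_j b j ord0 ^+ 2.
  rewrite -sqr_mean_trace (sqr_mean_bias hP hu hA1 s 0) (sqr_mean_bias hP hu hA1 s b).
  set m := mean_trajectory a x0 Pbar ubar s; set A := sqr_mean _ _ _ _ _ _ _.
  have A0 : 0 <= A.
    by apply: sumr_ge0 => j _; apply: Rintegral_ge0 => w _; exact: sqr_ge0.
  have : \sum_j (m j ord0 - (0 : 'cV[R]_n) j ord0) ^+ 2 <=
      2 * \sum_j (m j ord0 - b j ord0) ^+ 2 + 2 * \sum_j b j ord0 ^+ 2.
    rewrite !mulr_sumr -big_split/=; apply: ler_sum => j _; rewrite mxE subr0.
    have := sqr_ge0 (m j ord0 - 2 * b j ord0); move: (m j ord0) (b j ord0) => y z; lra.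
  lra.
have trN s : \tr (noise_moment mu a P u x0 Pbar ubar s) <=
    n%:R * K * (1 + 2 * C * L (V s) + 2 * \sum_j b j ord0 ^+ 2).
  apply: (@le_trans _ _ (\sum_(i < n) K * (1 + sqr_mean mu a P u x0 s 0))).
    by apply: ler_sum => i _; exact: hK.
  rewrite sumr_const card_ord -[leLHS]mulr_natl mulrA ler_wpM2l ?mulr_ge0//.
  by have := q_le s; have [_ ? _] := Lpsd _ (Vpsd s); lra.
have step s : L (V s.+1) <= (1 - t s * lam + t s ^+ 2 * C) * L (V s) +
    t s ^+ 2 * (C * (n%:R * K * (1 + 2 * C * L (V s) + 2 * \sum_j b j ord0 ^+ 2))).
  have aH : a s *: (1%:M - Pbar) = t s *: (e *: (1%:M - Pbar)).
    by rewrite scalerA aE mulrC.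
  have := second_moment_step hP hu hA1 s b; rewrite bE subrr scaler0 addr0 aH => VS.
  rewrite {1}/V VS Llin; apply: lerD.
    by apply: Lstep; [exact: second_moment_sym | exact: Vpsd | exact: t0].
  have -> : a s ^+ 2 = t s ^+ 2 by rewrite aE exprMn e2 mul1r.
  rewrite ler_wpM2l ?sqr_ge0//.
  have [_ _ /le_trans] := Lpsd _ (Npsd s); apply.
  by rewrite ler_wpM2l.
(* The gain makes [t s * lam] equal to [3 / (s + 1)], the decay needed, and [t s ^+ 2] equal to
   [9 / lam^2 / (s + 1)^2]. [D] collects all terms of second order, those multiplying [L (V s)] and
   those standing alone. *)
pose D := 9 / lam ^+ 2 * (C + C * (n%:R * K * (1 + 2 * C + 2 * \sum_j b j ord0 ^+ 2))).
have nK0 : 0 <= n%:R * K by rewrite mulr_ge0.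
have D0 : 0 <= D.
  apply: mulr_ge0; first by rewrite divr_ge0// sqr_ge0.
  by rewrite addr_ge0// mulr_ge0// mulr_ge0// !addr_ge0// mulr_ge0.
have LV : L (V s) @[s --> \oo] --> (0 : R).
  apply: (recursion_cvg0 D0) => s; first by have [] := Lpsd _ (Vpsd s).
  have L0 : 0 <= L (V s) by have [] := Lpsd _ (Vpsd s).
  apply: (le_trans (step s)).
  have -> : t s * lam = 3 / s.+1%:R by rewrite /t; field; rewrite (gt_eqF lam0) andbT.
  have -> : D / s.+1%:R ^+ 2 =
      t s ^+ 2 * (C + C * (n%:R * K * (1 + 2 * C + 2 * \sum_j b j ord0 ^+ 2))).
    rewrite /D /t; field; rewrite (gt_eqF lam0) andbT.
    by rewrite lt0r_neq0.
  move: (3 / _) (t s ^+ 2) (sqr_ge0 (t s)) (n%:R * K) nK0 (\sum_j _) b2 (L (V s)) L0.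
  move=> X tau tau0 k k0 B B0 l l0.
  have := mulr_ge0 C0 (mulr_ge0 k0 l0); have := mulr_ge0 C0 (mulr_ge0 k0 C0).
  have := mulr_ge0 C0 (mulr_ge0 k0 (mulr_ge0 B0 l0)) => h1 h2 h3.
  rewrite -subr_ge0 [leRHS](_ : _ =
    tau * (C * (k * l) + 2 * (C * (k * (B * l))) + C + 2 * (C * (k * C)))); last by ring.
  by rewrite mulr_ge0//; lra.
apply: (@squeeze_cvgr _ _ _ _ (cst 0) (fun s => C * L (V s))).
- near=> s; rewrite sqr_mean_trace; have [_ -> _] := Lpsd _ (Vpsd s); rewrite andbT.
  rewrite -sqr_mean_trace; apply: sumr_ge0 => j _.
  by apply: Rintegral_ge0 => w _; exact: sqr_ge0.
- exact: cvg_cst.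
- by rewrite -(mulr0 C); apply: cvgM; [exact: cvg_cst | exact: LV].
Unshelve. all: end_near. Qed.

Lemma mean_square_necessary (c d0 d1 : R) (b : 'cV[R]_n) (p1 r1 p2 r2 : 'rV[R]_n)
    (al1 be1 al2 be2 : R) :
  0 < c -> 0 <= d0 -> 0 <= d1 ->
  0 < d0 \/ [/\ 0 < d1, ubar != 0 & x0 != 0] ->
  noise_noncancelling mu P u x c ->
  (forall s i j A, sigma_of (x s) A ->
     (d1%:E * mu A <= \int[mu]_(w in A) ((P s w i j - Pbar i j) ^+ 2)%:E)%E) ->
  (forall s i A, sigma_of (x s) A ->
     (d0%:E * mu A <= \int[mu]_(w in A) ((u s w i ord0 - ubar i ord0) ^+ 2)%:E)%E) ->
  b != x0 -> cvg_mean_square mu x b ->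
  (p1 != 0) || (r1 != 0) -> (p2 != 0) || (r2 != 0) ->
  p1 *m Pbar = al1 *: p1 - be1 *: r1 -> r1 *m Pbar = be1 *: p1 + al1 *: r1 ->
  p2 *m Pbar = al2 *: p2 - be2 *: r2 -> r2 *m Pbar = be2 *: p2 + al2 *: r2 ->
  al2 <= 1 <= al1 -> False.
Proof.
move=> c0 d00 d10 noisy hnc low1 low0 bx0 cvgx pr1 pr2 p1E r1E p2E r2E /andP[al2_le al1_ge].
have low := noise_moment_ge hP hu hA1 c0 d00 d10 hnc low1 low0.
pose m := mean_trajectory a x0 Pbar ubar.
have q_split s y : sqr_mean mu a P u x0 s y =
    \tr (second_moment mu a P u x0 s (m s)) + \sum_j (m s j ord0 - y j ord0) ^+ 2.
  by rewrite (sqr_mean_bias hP hu hA1) sqr_mean_trace.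
have trS0 s : 0 <= \tr (second_moment mu a P u x0 s (m s)).
  rewrite -sqr_mean_trace; apply: sumr_ge0 => j _.
  by apply: Rintegral_ge0 => w _; exact: sqr_ge0.
have cvgq : sqr_mean mu a P u x0 s b @[s --> \oo] --> (0 : R).
  exact/(cvg_mean_squareE hP hu hA1).
(* The eigenvectors of [Pbar] are those of [H], an eigenvalue [z] becoming [1 - z]. *)
have toH (p r : 'rV[R]_n) al be :
    p *m Pbar = al *: p - be *: r -> r *m Pbar = be *: p + al *: r ->
    p *m (1%:M - Pbar) = (1 - al) *: p - (- be) *: r /\
    r *m (1%:M - Pbar) = (- be) *: p + (1 - al) *: r.
  move=> pE rE; rewrite !mulmxBr !mulmx1 pE rE; split; apply/rowP => j; rewrite !mxE; ring.
have [e1 f1] := toH _ _ _ _ p1E r1E; have [e2 f2] := toH _ _ _ _ p2E r2E.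
have cvgm j : m s j ord0 @[s --> \oo] --> b j ord0.
  have h : (m s j ord0 - b j ord0) ^+ 2 @[s --> \oo] --> (0 : R).
    apply: (@squeeze_cvgr _ _ _ _ (cst 0) (fun s => sqr_mean mu a P u x0 s b)) => //.
    - near=> s; rewrite sqr_ge0/= q_split (bigD1 j)//= addrCA lerDl addr_ge0//.
      by apply: sumr_ge0 => i _; exact: sqr_ge0.
    - exact: cvg_cst.
  apply/cvgrPdist_lt => eps eps0.
  have e20 : 0 < eps ^+ 2 by rewrite exprn_gt0.
  have [N _ hN] : \forall s \near \oo, (m s j ord0 - b j ord0) ^+ 2 < eps ^+ 2.
    by move/cvgr_lt : h; apply.
  exists N => // s Ns; have /= := hN s Ns.
  by rewrite -[X in X < _]real_normK ?num_real// ltr_sqr ?nnegrE ?(ltW eps0)// distrC.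
have Sstep s : second_moment mu a P u x0 s.+1 (m s.+1) = _ :=
  second_moment_step hP hu hA1 s (m s).
have mstep s : m s.+1 = m s + a s *: (ubar - (1%:M - Pbar) *m m s) by [].
have Nlow s (v : 'rV[R]_n) : qform 1%:M v * (c * d0 + c * d1 *
    (\tr (second_moment mu a P u x0 s (m s)) + \sum_j m s j ord0 ^+ 2)) <=
    qform (noise_moment mu a P u x0 Pbar ubar s) v.
  have := low s v; rewrite q_split; under eq_bigr do rewrite mxE subr0.
  by rewrite /qform mulmx1.
have noisy' : 0 < c * d0 \/ [/\ 0 < c * d1, ubar != 0 & m 0 != 0].
  by case: noisy => [d0p|[d1p u0 x00]]; [left | right; split=> //]; exact: mulr_gt0.
have cvgS : \tr (second_moment mu a P u x0 s (m s)) @[s --> \oo] --> (0 : R).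
  apply: (@squeeze_cvgr _ _ _ _ (cst 0) (fun s => sqr_mean mu a P u x0 s b)) => //.
  - near=> s; rewrite trS0 q_split lerDl; apply: sumr_ge0 => j _; exact: sqr_ge0.
  - exact: cvg_cst.
have a1 : 1 - al1 <= 0 by lra.
have a2 : 0 <= 1 - al2 by lra.
exact: (no_opposite_eigenvalues Sstep mstep
  (fun s => second_moment_ge0 hP hu hA1 s (m s)) Nlow (second_moment0 mu a P u x0)
  (mulr_ge0 (ltW c0) d00) (mulr_ge0 (ltW c0) d10) bx0 noisy' cvgS cvgm
  pr1 pr2 e1 f1 e2 f2 a1 a2).
Unshelve. all: end_near. Qed.

End mean_square_convergence.

(* [P a s] and [u a s] are the matrix and the vector P(s), u(s) met by the
   system run with the gain sequence [a]: their law given x(s) may depend on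
   x(s), hence on the gains.  Taking [P] and [u] constant in [a] gives the case
   of exogenous P(s), u(s).

   Under (A1), if [x0] solves [Pbar *m x0 + ubar = x0] then every x(s) has mean
   [x0] whatever the gains, so [x0] is the only possible deterministic limit;
   [hx0] excludes this case, in which the equivalence fails. *)
Theorem theorem3p8 (R : realType) (d : measure_display) (T : measurableType d)
    (mu : probability T R) (n : nat) (hn : (0 < n)%N)
    (P : (nat -> R) -> nat -> T -> 'M[R]_n)
    (u : (nat -> R) -> nat -> T -> 'cV[R]_n)
    (x0 : 'cV[R]_n) (Pbar : 'M[R]_n) (ubar : 'cV[R]_n)
    (x := fun a : nat -> R => trajectory a (P a) (u a) x0)
    (hP : forall a s i j, measurable_fun setT (fun w => P a s w i j))
    (hu : forall a s i, measurable_fun setT (fun w => u a s w i ord0))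
    (hA1 : forall a, A1 mu (P a) (u a) (x a) Pbar ubar)
    (hc : forall a, exists2 c : R, 0 < c < 1 &
       noise_noncancelling mu (P a) (u a) (x a) c)
    (hnoise : forall a,
       noisy_input mu (u a) (x a) ubar \/
       [/\ noiseless_input mu (u a) (x a) ubar, ubar != 0, x0 != 0 &
           noisy_matrix mu (P a) (x a) Pbar])
    (hx0 : Pbar *m x0 + ubar != x0) :
  (exists (a : nat -> R) (b : 'cV[R]_n),
     b != x0 /\ cvg_mean_square mu (x a) b)
  <->
  (rho_max Pbar < 1 \/ 1 < rho_min Pbar).
Proof.
split=> [[a [b [bx0 cvgx]]]|rho].
  apply: contrapT => /not_orP[/negP maxge /negP minle].
  rewrite -leNgt in maxge; rewrite -leNgt in minle.
  have [[z1 /= eig1 z1E] _] := rho_max_attained Pbar hn.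
  have [[z2 /= eig2 z2E] _] := rho_min_attained Pbar hn.
  have [p1 [r1 [pr1 p1E r1E]]] := real_eigenpair eig1.
  have [p2 [r2 [pr2 p2E r2E]]] := real_eigenpair eig2.
  have [c /andP[c0 _] hnc] := hc a.
  have Gm s := sigma_of_trajectory (hP a) (hu a) (hA1 a) (s := s).
  have z12 : complex.Re z2 <= 1 <= complex.Re z1 by rewrite z1E z2E maxge minle.
  (* Each noise condition supplies one of the two lower bounds [d0], [d1]; the other is taken to be
     0. *)
  have zero_low (f : T -> R) A : (0%:E * mu A <= \int[mu]_(w in A) (f w ^+ 2)%:E)%E.
    by rewrite mul0e integral_ge0// => w _; rewrite lee_fin sqr_ge0.
  case: (hnoise a) => [[delta delta0 low]|[_ u0 x00 [delta delta0 low]]].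
    apply: (mean_square_necessary (hP a) (hu a) (hA1 a) c0 (ltW delta0) (lexx 0) _ hnc
      _ _ bx0 cvgx pr1 pr2 p1E r1E p2E r2E z12) => //; first by left.
    by move=> s i A; exact: (cond_exp_ge_integral (@Gm s) (low s i)).
  apply: (mean_square_necessary (hP a) (hu a) (hA1 a) c0 (lexx 0) (ltW delta0) _ hnc
    _ _ bx0 cvgx pr1 pr2 p1E r1E p2E r2E z12) => //; first by right.
  by move=> s i j A; exact: (cond_exp_ge_integral (@Gm s) (low s i j)).
(* [e = 1] when the spectrum of [Pbar] lies to the left of 1; [e = -1], hence negative gains, when
   it lies to the right. *)
have [e [e2 e0 eigH]] : exists e : R, [/\ e ^+ 2 = 1, e != 0 &
    forall z, eigenvalue (map_mx (real_complex R) (e *: (1%:M - Pbar))) z ->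
      0 < complex.Re z].
  have mem y : eigenvalue (map_mx (real_complex R) Pbar) y ->
    re_eigenvalues Pbar (complex.Re y) by exists y.
  case: rho => rho.
    exists 1; split; [exact: expr1n | exact: oner_neq0 | move=> z eigz].
    have /mem := eigenvalue_affine (oner_neq0 R) eigz.
    move=> /(rho_max_attained Pbar hn).2.
    have -> : complex.Re (1 - (real_complex R 1)^-1 * z) = 1 - complex.Re z.
      by rewrite rmorph1 invr1 mul1r; case: z {eigz}.
    by lra.
  have N1 : (-1 : R) != 0 by rewrite oppr_eq0 oner_eq0.
  exists (-1); split; [by rewrite sqrrN expr1n | exact: N1 | move=> z eigz].
  have /mem := eigenvalue_affine N1 eigz.
  move=> /(rho_min_attained Pbar hn).2.
  have -> : complex.Re (1 - (real_complex R (-1))^-1 * z) = 1 + complex.Re z.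
    by rewrite rmorphN1 invrN1 mulN1r opprK; case: z {eigz}.
  by lra.
(* A kernel vector would be an eigenvector for 0, whose real part is not positive. *)
have Hunit : 1%:M - Pbar \in unitmx.
  rewrite unitmxE unitfE; apply/negP => /det0P[v v0 vH].
  have : 0 < complex.Re (0 : R[i]).
    apply: eigH; apply/eigenvalueP; exists (map_mx (real_complex R) v).
      by rewrite -map_mxM -scalemxAr vH scaler0 map_mx0 scale0r.
    by rewrite map_mx_eq0.
  by rewrite ltxx.
pose b := invmx (1%:M - Pbar) *m ubar.
have bE : (1%:M - Pbar) *m b = ubar by rewrite mulKVmx.
have [L [lam [C [lam0 C0 Llin Lpsd Lstep]]]] := lyapunov hn eigH.
exists (fun s => e * (3 / lam / s.+1%:R)), b; split.
  (* If [b] were [x0], then [(1 - Pbar) x0 = ubar], the fixed-point case that [hx0] excludes. *)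
  apply: contra hx0 => /eqP <-; rewrite -{1}bE mulmxBl mul1mx addrC subrK.
  exact: eqxx.
exact: (mean_square_sufficient (hP _) (hu _) (hA1 _) lam0 C0 e2 (fun=> erefl)
  Llin Lpsd Lstep bE).
Qed.
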